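(* Let $\kappa\ge1$, let $x$ be a complex random variable with $\kappa$-controlled second moment, let $0<\mu\le1$, $\varepsilon>0$, $r\ge1$, let $v_1,\dots,v_r$ be complex numbers, and let $L_1,\dots,L_r>0$ be such that $L_1^2,\dots,L_r^2$ are integers. Let $$Q=\mathrm{Q}\big((v_1,\dots,v_r),(\sqrt\mu L_1,\dots,\sqrt\mu L_r)\big).$$ Then $$\mathbf{P}_\mu\big(v_1^{L_1^2}\cdots v_r^{L_r^2}\big)\le C\,\mathbf{D}(Q)^{-1+\varepsilon},$$ where $C$ depends only on $\varepsilon$, $r$ and $\kappa$.
   Context: For $\kappa\ge1$, a complex random variable $x$ has $\kappa$-controlled second moment if $\mathbf{E}|x|^2\le\kappa$ and, for all complex numbers $z,w$, $\mathbf{E}\big[(\mathrm{Re}(zx-w))^2\,\mathbf{1}_{|x|\le\kappa}\big]\ge\frac1\kappa(\mathrm{Re}\,z)^2$. For $0<\mu\le1$ let $x^{(\mu)}=(x_1-x_2)\mathbf{I}_{\mu/2}$, where $x_1,x_2$ are i.i.d. copies of $x$ and $\mathbf{I}_{\mu/2}$ is independent of them, equal to $1$ with probability $\mu/2$ and $0$ otherwise. For a tuple $\mathbf{w}=(w_1,\dots,w_n)$ of complex numbers, $\mathbf{P}_\mu(\mathbf{w})=\mathbf{E}\exp(-\pi|W|^2)$ with $W=w_1y_1+\dots+w_ny_n$ and $y_1,\dots,y_n$ i.i.d. copies of $x^{(\mu)}$. The tuple $v_1^{L_1^2}\cdots v_r^{L_r^2}$ is the concatenation of $L_1^2$ copies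 of $v_1$, ..., $L_r^2$ copies of $v_r$. For complex $v_1,\dots,v_r$ and positive reals $M_1,\dots,M_r$, the symmetric generalized arithmetic progression is the set $\mathrm{Q}((v_1,\dots,v_r),(M_1,\dots,M_r))=\{n_1v_1+\dots+n_rv_r:\ n_i\in\mathbf{Z},\ |n_i|\le M_i\}\subset\mathbf{C}$. Its dispersion is $\mathbf{D}(Q)=\#Q/\#(Q\cap B(0,1))$, with $B(0,1)$ the closed unit disk. *)

(* Defs.v *)
From HB Require Import structures.
From mathcomp Require Import all_boot all_order all_algebra finmap.
From mathcomp Require Import all_classical all_reals all_analysis.
From mathcomp Require Import complex.

Set Implicit Arguments.
Unset Strict Implicit.
Unset Printing Implicit Defensive.

Import Order.TTheory GRing.Theory Num.Theory.
Import numFieldNormedType.Exports.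

Local Open Scope classical_set_scope.
Local Open Scope ring_scope.

Notation cabs := ComplexField.Normc.normc.

(* The Borel structure of the complex plane is that of R * R, through reim. *)
Definition reim (R : realType) (z : R[i]) : R * R := (complex.Re z, complex.Im z).

Definition complexRV (R : realType) (d : measure_display) (T : measurableType d)
    (x : T -> R[i]) : Prop :=
  measurable_fun [set: T] (@reim R \o x).

Definition same_law (R : realType) (d d' : measure_display)
    (T : measurableType d) (T' : measurableType d')
    (P : probability T R) (x : T -> R[i])
    (P' : probability T' R) (x' : T' -> R[i]) : Prop :=
  forall A : set (R * R), measurable A ->
    P ((@reim R \o x) @^-1` A) = P' ((@reim R \o x') @^-1` A).

Definition independent2 (R : realType) (d d1 d2 : measure_display)
    (T : measurableType d) (E1 : measurableType d1) (E2 : measurableType d2)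
    (P : probability T R) (X : T -> E1) (Y : T -> E2) : Prop :=
  forall (A : set E1) (B : set E2), measurable A -> measurable B ->
    P ((X @^-1` A) `&` (Y @^-1` B)) = (P (X @^-1` A) * P (Y @^-1` B))%E.

(* Some of the A j may be the whole plane, so the product rule for every
   subfamily is included. *)
Definition mutually_independent (R : realType) (d : measure_display)
    (T : measurableType d) (P : probability T R) (n : nat)
    (y : 'I_n -> T -> R[i]) : Prop :=
  forall A : 'I_n -> set (R * R), (forall j, measurable (A j)) ->
    P (\bigcap_(j in [set: 'I_n]) ((@reim R \o y j) @^-1` A j)) =
    (\prod_(j < n) P ((@reim R \o y j) @^-1` A j))%E.

Definition iid_copies (R : realType) (d d' : measure_display)
    (T : measurableType d) (T' : measurableType d')
    (P : probability T R) (x : T -> R[i])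
    (P' : probability T' R) (n : nat) (y : 'I_n -> T' -> R[i]) : Prop :=
  [/\ forall j, complexRV (y j),
      forall j, same_law P x P' (y j)
    & mutually_independent P' y].

Definition controlled_second_moment (R : realType) (d : measure_display)
    (T : measurableType d) (P : probability T R) (kappa : R) (x : T -> R[i])
    : Prop :=
  ('E_P[(fun t => cabs (x t) ^+ 2)%R] <= kappa%:E)%E /\
  (forall z w : R[i],
     ((kappa^-1 * complex.Re z ^+ 2)%R%:E <=
      'E_P[(fun t => complex.Re (z * x t - w) ^+ 2 *
                     \1_[set u | cabs (x u) <= kappa] t)%R])%E).

(* xmu is a version of x^(mu) = (x_1 - x_2) I_{mu/2}. *)
Definition lazy_difference (R : realType) (d d' : measure_display)
    (T : measurableType d) (T' : measurableType d')
    (P : probability T R) (x : T -> R[i]) (mu : R)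
    (P' : probability T' R) (xmu : T' -> R[i]) : Prop :=
  exists (x1 x2 : T' -> R[i]) (I : T' -> bool),
    [/\ [/\ complexRV x1, complexRV x2 & measurable_fun [set: T'] I],
        [/\ same_law P x P' x1, same_law P x P' x2
          & independent2 P' (@reim R \o x1) (@reim R \o x2)],
        P' (I @^-1` [set true]) = (mu / 2)%:E,
        independent2 P' (fun t => (reim (x1 t), reim (x2 t))) I
      & forall t, xmu t = (x1 t - x2 t) * (I t)%:R].

(* E exp(-pi |W|^2) with W = sum_j w_j y_j; it is P_mu(w) when the y_j are
   i.i.d. copies of x^(mu). *)
Definition gaussian_mean (R : realType) (d : measure_display)
    (T : measurableType d) (P : probability T R) (w : seq R[i])
    (y : 'I_(size w) -> T -> R[i]) : \bar R :=
  'E_P[(fun t =>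
    expR (- (pi * cabs (\sum_(j < size w) w`_j * y j t) ^+ 2)))%R]%E.

(* v_1^{L_1^2} ... v_r^{L_r^2}; truncn is exact on the natural number L_i^2. *)
Definition repeated_tuple (R : realType) (r : nat) (v : 'I_r -> R[i])
    (L : 'I_r -> R) : seq R[i] :=
  flatten [seq nseq (Num.truncn (L i ^+ 2)) (v i) | i <- enum 'I_r].

Definition symGAP (R : realType) (r : nat) (v : 'I_r -> R[i]) (M : 'I_r -> R)
    : set R[i] :=
  [set z | exists2 n : 'I_r -> int,
             (forall i, `|n i|%:~R <= M i) & z = \sum_(i < r) (n i)%:~R * v i].

(* fset_set is the junk value fset0 on infinite sets; a symGAP is finite. *)
Definition dispersion (R : realType) (Q : set R[i]) : R :=
  (#|` fset_set Q|)%:R / (#|` fset_set (Q `&` [set z | cabs z <= 1])|)%:R.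

(* Main.v *)
Require Import Defs.
From HB Require Import structures.
From mathcomp Require Import all_boot all_order all_algebra finmap.
From mathcomp Require Import all_classical all_reals all_analysis.
From mathcomp Require Import complex measurable_realfun ring lra zify.
Import Order.TTheory GRing.Theory Num.Theory.
Import numFieldNormedType.Exports.
Local Open Scope classical_set_scope.
Local Open Scope ring_scope.

Set Implicit Arguments.
Unset Strict Implicit.
Unset Printing Implicit Defensive.

(* Write y for a difference of two independent copies of x.  The Gaussian is bounded by
   a finite combination, with nonnegative coefficients, of cosines of real-linear forms
   of W (a truncated Poisson kernel of large period in each coordinate).  The mean of
   each cosine is a product of the values 1 - (mu/2) E[1 - cos(form(v_i y))] of a
   characteristic function, hence at most exp(- E sum_i (M_i^2/2)(1 - cos(form(v_i y))))
   with M_i = sqrt(mu) L_i.  By Jensen's inequality the expectation over y may be taken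
   outside the exponential and restricted to an event of probability bounded below on
   which |y| is bounded above and below, so y can be fixed.  Each factor
   exp(- c M_i^2 (1 - cos t)) is at most a constant times a Poisson kernel, whose Fourier
   coefficients are nonnegative, at most a constant over M_i, and decay geometrically at
   scale M_i.  Expanding these kernels and summing the cosines back gives a sum over
   n in Z^r of weights times a function of y(n_1 v_1 + ... + n_r v_r) that decays
   quadratically in each coordinate.  Cutting Z^r into boxes of sides M_i and the plane
   into small squares bounds it by a constant times the proportion of n in the box with
   |n_1 v_1 + ... + n_r v_r| <= 1, which is at most a constant over the dispersion.
   This gives the exponent -1, and the dispersion is at least 1. *)

(** * Poisson kernels as finite cosine sums *)

(** Mean value theorem at 0. The factor [cos u] stays explicit because it serves twice: bounded by 1
    it gives the upper bound on 1 - cos, and close to 1 it gives the lower bound. *)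
Lemma sin_MVT0 (R : realType) (x : R) :
  exists2 u : R, `|u| <= `|x| & sin x = cos u * x.
Proof.
wlog x0 : x / 0 <= x.
  move=> H; have [/H //|x0] := leP 0 x.
  have [|u hu e] := H (- x); first by rewrite oppr_ge0 ltW.
  exists u; first by rewrite -(normrN x).
  by apply: oppr_inj; rewrite -sinN e mulrN.
case: (eqVneq x 0) => [->|xn0]; first by exists 0; rewrite ?mulr0 ?sin0.
have xp : 0 < x by rewrite lt_def xn0.
have [|c /itvP cI e] := @MVT R sin cos 0 x xp (fun t _ => is_derive_sin t).
  by apply: continuous_subspaceT => t; apply: continuous_sin.
exists c; first by rewrite !ger0_norm ?cI.
by move: e; rewrite sin0 !subr0.
Qed.

Lemma one_sub_cos (R : realType) (t : R) : 1 - cos t = 2 * sin (t / 2) ^+ 2.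
Proof.
have {1}-> : t = (t / 2) *+ 2 by rewrite -mulr_natr; field.
by rewrite cos_mulr2n; have := cos2Dsin2 (t / 2); lra.
Qed.

Lemma one_sub_cos_le (R : realType) (t : R) : 1 - cos t <= t ^+ 2 / 2.
Proof.
rewrite one_sub_cos; have [u _ ->] := sin_MVT0 (t / 2).
have : cos u ^+ 2 <= 1 by rewrite -(cos2Dsin2 u) lerDl sqr_ge0.
rewrite exprMn; have := sqr_ge0 t; nra.
Qed.

Lemma one_sub_cos_ge (R : realType) (t : R) :
  `|t| <= 1 -> t ^+ 2 / 4 <= 1 - cos t.
Proof.
move=> t1; rewrite one_sub_cos; have [u hu ->] := sin_MVT0 (t / 2).
have u2 : `|u| <= 1 / 2.
  by apply: le_trans hu _; rewrite normrM (@ger0_norm _ 2^-1) ?invr_ge0 //; lra.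
have hc : 7 / 8 <= cos u.
  have := one_sub_cos_le u; have : u ^+ 2 <= 1 / 4.
    by rewrite -real_normK ?num_real //; have := normr_ge0 u; nra.
  lra.
have c2 : 1 / 2 <= cos u ^+ 2 by nra.
have -> : 2 * (cos u * (t / 2)) ^+ 2 = t ^+ 2 * cos u ^+ 2 / 2 by field.
by have := ler_wpM2l (sqr_ge0 t) c2; lra.
Qed.

(* The Poisson kernel (1 - rho)^2 / (1 - 2 rho cos t + rho^2) with rho = 1 - 1/m. *)
Definition pkernel (R : realType) (m : nat) (t : R) : R :=
  (1 + 2 * m%:R * (m%:R - 1) * (1 - cos t))^-1.

(** The recurrence 2 cos t cos((N+1)t) = cos((N+2)t) + cos(Nt) makes the product with the Poisson
    denominator collapse, so that truncation leaves only two explicit boundary terms. *)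
Lemma poisson_partial_sum (R : realType) (rho t : R) (N : nat) :
  (1 - 2 * rho * cos t + rho ^+ 2) *
    (2 * \sum_(j < N.+1) rho ^+ j * cos (j%:R * t) - 1) =
  1 - rho ^+ 2 - 2 * rho ^+ N.+1 * cos (N.+1%:R * t)
    + 2 * rho ^+ N.+2 * cos (N%:R * t).
Proof.
elim: N => [|N IH].
  by rewrite big_ord1 expr0 mul0r cos0 !mul1r expr1; ring.
rewrite big_ord_recr /=; move: IH; set S := \sum_(j < N.+1) _ => IH.
rewrite [2 * (S + _)]mulrDr [2 * S + _ - 1]addrAC [LHS]mulrDr {}IH.
have e : 2 * cos t * cos (N.+1%:R * t) = cos (N.+2%:R * t) + cos (N%:R * t).
  have -> : N.+2%:R * t = N.+1%:R * t + t by rewrite -(natr1 N.+1); ring.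
  have -> : N%:R * t = N.+1%:R * t - t by rewrite -(natr1 N); ring.
  by rewrite cosD cosB; ring.
have -> : cos (N.+2%:R * t) = 2 * cos t * cos (N.+1%:R * t) - cos (N%:R * t).
  by rewrite e addrK.
by rewrite !exprS; ring.
Qed.

Lemma expr_lt_eventually (R : realType) (rho e : R) :
  0 <= rho < 1 -> 0 < e -> exists N, forall n, (N <= n)%N -> rho ^+ n <= e.
Proof.
move=> /andP[r0 r1] e0.
have : (fun n => rho ^+ n) @ \oo --> (0 : R) by apply: cvg_expr; rewrite ger0_norm.
move/cvgrPdist_le => /(_ e e0) [N _ H]; exists N => n Nn.
by have := H n Nn; rewrite /= sub0r normrN ger0_norm ?exprn_ge0.
Qed.

(** With q = 1/m and rho = 1 - q, the kernel is the full series q/(1+rho) (2 sum rho^j cos(jt) - 1),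
    so its coefficients have size about 1/m and decay geometrically at scale m. A threshold [N0] is
    given instead of one length so that several kernels can share the same N. *)
Lemma pkernel_trunc (R : realType) (m : nat) (delta : R) :
  (0 < m)%N -> 0 < delta ->
  exists N0, forall N, (N0 <= N)%N ->
  exists d : nat -> R, [/\
    forall j, 0 <= d j <= (m%:R^-1 + delta) * (1 - m%:R^-1) ^+ j &
    forall t : R,
      pkernel m t <= 2 * \sum_(j < N) d j * cos (j%:R * t) <= pkernel m t + delta].
Proof.
move=> m0 dl0.
have mR : 1 <= m%:R :> R by rewrite ler1n.
have mR0 : 0 < m%:R :> R by lra.
set q := m%:R^-1 : R.
have q0 : 0 < q by rewrite invr_gt0.
have q1 : q <= 1 by rewrite invf_le1.
set rho := 1 - q.
have r0 : 0 <= rho by rewrite /rho; lra.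
(* The truncation error will be A err / D with A <= q and D >= q^2, so |err| <= delta q / 2
   suffices; err has two terms, each at most twice a power of rho beyond [N0]. *)
have [||N0 HN0] := @expr_lt_eventually R rho (delta * q / 8).
- by rewrite r0 /rho; lra.
- by rewrite divr_gt0 // mulr_gt0.
exists N0.+1 => -[//|N]; rewrite ltnS => N0N.
pose A := q / (1 + rho).
have rp : 0 < 1 + rho by lra.
have A0 : 0 < A by rewrite divr_gt0.
have Aq : A <= q by rewrite ler_pdivrMr // ler_peMr; lra.
(* Half of the slack delta at the constant term absorbs the truncation error. *)
exists (fun j => A * rho ^+ j - (j == 0)%:R * (A / 2) + (j == 0)%:R * (delta / 4)).
split=> [j|t].
  case: (eqVneq j 0%N) => [->|jn0].
    by rewrite expr0 !mul1r !mulr1 /=; apply/andP; split; lra.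
  have := exprn_ge0 j r0 => rj0.
  rewrite !mul0r subr0 addr0; apply/andP; split.
    by rewrite mulr_ge0 // ltW.
  by apply: ler_wpM2r => //; lra.
have ct := cos_le1 t; have cg := cos_geN1 t.
have Den : 0 < 1 - 2 * rho * cos t + rho ^+ 2.
  apply: (@lt_le_trans _ _ (q ^+ 2)); first by rewrite exprn_gt0.
  rewrite /rho; nra.
set D := 1 - 2 * rho * cos t + rho ^+ 2 in Den *.
have Dq : q ^+ 2 <= D by rewrite /D /rho; nra.
have pkE : pkernel m t = q ^+ 2 / D.
  rewrite /pkernel; apply: (canRL (mulfK _)); first by rewrite gt_eqF.
  rewrite mulrC; apply: (canLR (mulfK _)).
    rewrite gt_eqF //; have : 0 <= m%:R * (m%:R - 1) * (1 - cos t) :> R.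
      by rewrite !mulr_ge0 //; lra.
    lra.
  have -> : m%:R = q^-1 by rewrite /q invrK.
  by rewrite /D /rho; field; rewrite gt_eqF.
have -> : 2 * (\sum_(j < N.+1) (A * rho ^+ j - (j == 0%N :> nat)%:R * (A / 2)
      + (j == 0%N :> nat)%:R * (delta / 4)) * cos (j%:R * t)) =
    A * (2 * (\sum_(j < N.+1) rho ^+ j * cos (j%:R * t)) - 1) + delta / 2.
  rewrite (eq_bigr (fun j : 'I_N.+1 => A * (rho ^+ j * cos (j%:R * t)) +
    (j == 0%N :> nat)%:R * (delta / 4 - A / 2))); last first.
    move=> j _; case: (eqVneq (j : nat) 0%N) => [->|_].
      by rewrite /= mul0r cos0; ring.
    by rewrite /=; ring.
  rewrite big_split /= -mulr_sumr [X in _ + X](bigD1 (ord0 : 'I_N.+1)) //=.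
  rewrite [X in _ + (_ + X)]big1 => [|j jn0]; last first.
    suff -> : (j == 0%N :> nat) = false by rewrite mul0r.
    by apply: contraNF jn0 => /eqP h; apply/eqP/val_inj.
  by field.
have := poisson_partial_sum rho t N; rewrite -/D.
set S := \sum_(j < N.+1) _.
set a := cos (N.+1%:R * t); set b := cos (N%:R * t).
move=> eS.
set err := - 2 * rho ^+ N.+1 * a + 2 * rho ^+ N.+2 * b.
have -> : A * (2 * S - 1) = pkernel m t + A * err / D.
  have Dn0 : D != 0 by rewrite gt_eqF.
  rewrite pkE; apply: (mulIf Dn0); rewrite [RHS]mulrDl !divfK //.
  rewrite -mulrA [_ * D]mulrC eS /err /A /rho.
  by field; rewrite gt_eqF //; move: rp; rewrite /rho; lra.
have eb : `|err| <= delta * q / 2.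
  have h1 : rho ^+ N.+1 <= delta * q / 8 by apply: HN0; rewrite leqW.
  have h2 : rho ^+ N.+2 <= delta * q / 8 by apply: HN0; rewrite leqW // leqW.
  have p1 := exprn_ge0 N.+1 r0; have p2 := exprn_ge0 N.+2 r0.
  have := cos_le1 (N.+1%:R * t); have := cos_geN1 (N.+1%:R * t).
  have := cos_le1 (N%:R * t); have := cos_geN1 (N%:R * t).
  rewrite -/a -/b /err ler_norml => *; apply/andP; split; nra.
have : `|A * err / D| <= delta / 2.
  rewrite normrM normfV normrM (gtr0_norm A0) (gtr0_norm Den) ler_pdivrMr //.
  apply: (@le_trans _ _ (q * (delta * q / 2))).
    by apply: ler_pM => //; rewrite ltW.
  have -> : q * (delta * q / 2) = delta / 2 * q ^+ 2 by ring.
  by rewrite ler_pM2l //; lra.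
rewrite ler_norml => /andP[h1 h2]; apply/andP; split; lra.
Qed.

(* Rescaling by m makes the kernel comparable to 1 / (1 + u^2). *)
Lemma pkernel_ge (R : realType) (m : nat) (u : R) :
  (0 < m)%N -> expR (- u ^+ 2) <= pkernel m (u / m%:R).
Proof.
move=> m0; have mR : 1 <= m%:R :> R by rewrite ler1n.
set t := u / m%:R; have ct := cos_le1 t; have := one_sub_cos_le t.
rewrite /pkernel expRN => h.
have ut : u ^+ 2 = m%:R ^+ 2 * t ^+ 2.
  by rewrite -exprMn /t mulrC divfK // gt_eqF //; lra.
have h0 : 0 <= m%:R * (m%:R - 1) * (1 - cos t) by rewrite !mulr_ge0 //; lra.
rewrite lef_pV2 ?posrE ?expR_gt0 //; last by lra.
apply: le_trans (expR_ge1Dx _); rewrite lerD2l ut.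
have h1 : m%:R * (m%:R - 1) <= m%:R ^+ 2 :> R by nra.
have h2 : m%:R * (m%:R - 1) * (1 - cos t) <= m%:R ^+ 2 * (t ^+ 2 / 2).
  by apply: ler_pM => //; try lra; rewrite mulr_ge0; lra.
lra.
Qed.

(** For m >= 2 one has m (m - 1) >= m^2 / 2, and |u| <= m keeps u / m in the range where 1 - cos t
    >= t^2 / 4. The kernel is periodic, so decay can hold only on a bounded window. *)
Lemma pkernel_le (R : realType) (m : nat) (u : R) :
  (1 < m)%N -> `|u| <= m%:R -> pkernel m (u / m%:R) <= (1 + u ^+ 2 / 4)^-1.
Proof.
move=> m1 um; have mR : 2 <= m%:R :> R by rewrite (ler_nat _ 2).
set t := u / m%:R; have ct := cos_le1 t.
have : `|t| <= 1.
  by rewrite normrM normfV (@ger0_norm _ m%:R) ?ler_pdivrMr ?mul1r //; lra.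
move/one_sub_cos_ge => h.
have ut : u ^+ 2 = m%:R ^+ 2 * t ^+ 2.
  by rewrite -exprMn /t mulrC divfK // gt_eqF //; lra.
have h0 : 0 <= m%:R * (m%:R - 1) * (1 - cos t) by rewrite !mulr_ge0 //; lra.
have u0 := sqr_ge0 u; have t0 := sqr_ge0 t.
rewrite /pkernel lef_pV2 ?posrE; [|lra|lra].
have h1 : m%:R ^+ 2 / 2 <= m%:R * (m%:R - 1) :> R by nra.
have h2 : m%:R ^+ 2 / 2 * (t ^+ 2 / 4) <= m%:R * (m%:R - 1) * (1 - cos t).
  by apply: ler_pM => //; lra.
rewrite ut; lra.
Qed.

(** A truncated Poisson kernel whose order m exceeds U. It dominates the Gaussian on the whole line
    but decays only on the window |u| <= U, which therefore has to be fixed before the period. *)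
Lemma gauss_cos_majorant (R : realType) (U : R) :
  exists (Lam : R) (N : nat) (d : nat -> R), [/\ 0 < Lam,
    forall j, 0 <= d j,
    forall u, expR (- u ^+ 2) <= 2 * \sum_(j < N) d j * cos (j%:R * (u / Lam)) &
    forall u, `|u| <= U ->
      2 * \sum_(j < N) d j * cos (j%:R * (u / Lam)) <= 2 * (1 + u ^+ 2 / 4)^-1].
Proof.
pose m := (Num.truncn U).+2.
have Um : U <= m%:R.
  have [U0|U0] := leP 0 U; last by rewrite (le_trans (ltW U0)) ?ler0n.
  by rewrite ltW // (lt_trans (truncnS_gt U)) // ltr_nat.
pose delta := (1 + m%:R ^+ 2 / 4)^-1 : R.
have m2 := sqr_ge0 (m%:R : R).
have [||N /(_ N (leqnn N))[d [d0 H]]] := @pkernel_trunc R m delta => //.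
  by rewrite invr_gt0; lra.
exists m%:R, N, d; split=> //.
- by move=> j; case/andP: (d0 j).
- by move=> u; case/andP: (H (u / m%:R)) => + _; apply: le_trans; apply: pkernel_ge.
move=> u uU; have um := le_trans uU Um.
case/andP: (H (u / m%:R)) => _ h; apply: le_trans h _.
rewrite mulr_natl mulr2n lerD // ?pkernel_le //.
have u2 : u ^+ 2 <= m%:R ^+ 2 by rewrite -(real_normK (num_real u)) lerXn2r ?nnegrE.
have u0 := sqr_ge0 u.
by rewrite lef_pV2 ?posrE; lra.
Qed.

(** * Products of cosine sums as sums over integer frequency vectors *)

(** A frequency is coded by a sign and a modulus. The frequency 0 has two codes, which matches the
    factor 2 in front of the constant term of the cosine sums. *)
Definition signed_val (N : nat) (p : bool * 'I_N) : int :=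
  if p.1 then - (p.2%:Z) else p.2%:Z.

Definition expi (R : realType) (t : R) : R[i] := (cos t +i* sin t)%C.

Lemma expiD (R : realType) (s t : R) : expi (s + t) = expi s * expi t.
Proof. by rewrite /expi cosD sinD; apply/eqP; rewrite eq_complex /= eqxx /= addrC. Qed.

Lemma expi_sum (R : realType) (I : finType) (t : I -> R) :
  expi (\sum_i t i) = \prod_i expi (t i).
Proof.
apply: (big_morph _ (@expiD R)).
by rewrite /expi cos0 sin0.
Qed.

Lemma signed_cos_sum (R : realType) (N : nat) (d : nat -> R) (t : R) :
  \sum_(p : bool * 'I_N) (d p.2)%:C%C * expi ((signed_val p)%:~R * t) =
  (2 * \sum_(j < N) d j * cos (j%:R * t))%:C%C.
Proof.
rewrite -(pair_bigA _ (fun b (j : 'I_N) =>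
  (d j)%:C%C * expi ((signed_val (b, j))%:~R * t))) /= big_bool /=.
rewrite -big_split /= mulr_sumr rmorph_sum; apply: eq_bigr => j _.
rewrite /signed_val /= mulrNz mulNr -pmulrn /expi cosN sinN -mulrDr.
by apply/eqP; rewrite eq_complex /=; apply/andP; split; apply/eqP; ring.
Qed.

(** In terms of complex exponentials the product expands by distributivity, and phases add up;
    taking real parts returns to cosines. *)
Lemma prod_cos_expand (R : realType) (I : finType) (N : nat)
    (d : I -> nat -> R) (t : I -> R) :
  \prod_i (2 * \sum_(j < N) d i j * cos (j%:R * t i)) =
  \sum_(f : {ffun I -> bool * 'I_N}) (\prod_i d i (f i).2) *
    cos (\sum_i (signed_val (f i))%:~R * t i).
Proof.
suff /(congr1 (@complex.Re R)) : (\prod_i (2 * \sum_(j < N) d i j * cos (j%:R * t i)))%:C%C =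
    \sum_(f : {ffun I -> bool * 'I_N}) (\prod_i d i (f i).2)%:C%C *
      expi (\sum_i (signed_val (f i))%:~R * t i).
  rewrite (big_morph (@complex.Re R) (id1 := 0) (op1 := +%R)) //=; last by case=> ? ? [].
  by move=> ->; apply: eq_bigr => f _; rewrite mul0r subr0.
rewrite rmorph_prod.
rewrite (eq_bigr _ (fun i _ => esym (signed_cos_sum N (d i) (t i)))).
rewrite bigA_distr_bigA /=; apply: eq_bigr => f _.
by rewrite big_split /= expi_sum rmorph_prod.
Qed.

(** * Counting in generalized arithmetic progressions *)

Definition lin_comb (R : realType) (r : nat) (v : 'I_r -> R[i]) (n : 'I_r -> int)
    : R[i] := \sum_(i < r) (n i)%:~R * v i.

(** The shift by N makes the integer vectors with entries in [-N, N] a finite type, in which boxes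
    of different sides, and their translates, can be compared. *)
Definition box_val (r N : nat) (g : {ffun 'I_r -> 'I_(N + N).+1}) (i : 'I_r) : int :=
  (g i)%:Z - N%:Z.

Definition box (r N : nat) (K : 'I_r -> nat) : {set {ffun 'I_r -> 'I_(N + N).+1}} :=
  [set g | [forall i, `|box_val g i|%N <= K i]%N].

Lemma lin_combB (R : realType) (r : nat) (v : 'I_r -> R[i]) (n s : 'I_r -> int) :
  lin_comb v (fun i => n i - s i) = lin_comb v n - lin_comb v s.
Proof. by rewrite /lin_comb -sumrB; apply: eq_bigr => i _; rewrite rmorphB mulrBl. Qed.

Lemma lin_combD (R : realType) (r : nat) (v : 'I_r -> R[i]) (n s : 'I_r -> int) :
  lin_comb v (fun i => n i + s i) = lin_comb v n + lin_comb v s.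
Proof. by rewrite /lin_comb -big_split; apply: eq_bigr => i _; rewrite rmorphD mulrDl. Qed.

Lemma eq_lin_comb (R : realType) (r : nat) (v : 'I_r -> R[i]) (n s : 'I_r -> int) :
  n =1 s -> lin_comb v n = lin_comb v s.
Proof. by move=> e; apply: eq_bigr => i _; rewrite e. Qed.

Lemma box_val_surj (r N : nat) (n : 'I_r -> int) :
  (forall i, `|n i| <= N)%N ->
  exists g : {ffun 'I_r -> 'I_(N + N).+1}, box_val g =1 n.
Proof.
move=> h; exists [ffun i => inord (absz (n i + N%:Z))] => i.
rewrite /box_val ffunE inordK; have := h i; lia.
Qed.

Lemma box_val_inj (r N : nat) (g g' : {ffun 'I_r -> 'I_(N + N).+1}) :
  box_val g =1 box_val g' -> g = g'.
Proof.
move=> e; apply/ffunP => i; apply: val_inj; have := e i.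
by rewrite /box_val => /addIr [].
Qed.

Lemma mem_box_val (r N : nat) (K : 'I_r -> nat) (g : {ffun 'I_r -> 'I_(N + N).+1}) :
  g \in box N K -> forall i, (`|box_val g i| <= K i)%N.
Proof. by rewrite inE => /forallP. Qed.

(** Translation by [s] is injective. The source type is abstract because it consists of box points
    in one use and of signed frequencies in another; injectivity of [nv] is asked on U only, since
    signed frequencies code 0 twice. *)
Lemma card_le_shift (r N : nat) (Y : finType) (nv : Y -> 'I_r -> int)
    (U : {set Y}) (V : {set {ffun 'I_r -> 'I_(N + N).+1}}) (s : 'I_r -> int) :
  {in U &, forall f g, nv f =1 nv g -> f = g} ->
  (forall f, f \in U -> exists2 g, g \in V & box_val g =1 (fun i => nv f i + s i)) ->
  (#|U| <= #|V|)%N.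
Proof.
move=> inj H.
pose h f := odflt [ffun=> ord0]
  [pick g | (g \in V) && [forall i, box_val g i == nv f i + s i]].
have hP f : f \in U -> h f \in V /\ box_val (h f) =1 (fun i => nv f i + s i).
  move=> /H[g gV eg]; rewrite /h; case: pickP => [g' /andP[g'V /forallP e]|/(_ g)] /=.
    by split=> // i; apply/eqP.
  by rewrite gV /=; move/negP; case; apply/forallP => i; rewrite eg.
rewrite -(@card_in_imset _ _ h U) => [|f g fU gU e].
  by apply/subset_leq_card/fintype.subsetP => _ /imsetP[f /hP[hV _] ->].
apply: inj => // i; have [_ /(_ i) ef] := hP f fU; have [_ /(_ i) eg] := hP g gU.
by move: ef; rewrite e eg => /addIr.
Qed.

Lemma card_box (r N : nat) (K : 'I_r -> nat) :
  (#|box N K| <= \prod_(i < r) (K i + K i).+1)%N.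
Proof.
pose F i : pred 'I_(N + N).+1 := fun x => (absz (x%:Z - N%:Z) <= K i)%N.
have -> : #|box N K| = #|family F|.
  by apply: eq_card => g; rewrite !inE.
rewrite card_family foldrE big_image /=; apply: leq_prod => i _.
rewrite -[leqRHS](card_ord (K i + K i).+1).
pose h (x : 'I_(N + N).+1) : 'I_(K i + K i).+1 := inord (x + K i - N).
apply: (@leq_card_in _ _ h) => x y.
move=> xK yK /(congr1 val).
have {}xK : (absz (x%:Z - N%:Z) <= K i)%N := xK.
have {}yK : (absz (y%:Z - N%:Z) <= K i)%N := yK.
by rewrite /h /= !inordK; [|lia|lia] => e; apply: val_inj => /=; lia.
Qed.

(** Duplicates are removed, so the size counts the elements of the progression and not their
    representations. *)
Definition gap_seq (R : realType) (r N : nat) (v : 'I_r -> R[i]) (K : 'I_r -> nat)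
    : seq R[i] := undup [seq lin_comb v (box_val g) | g <- enum (box N K)].

(* Fibers over the progression may be large when it is not proper; each of them is at
   most F, the number of relations in the doubled box, and F translates into every
   fiber of the tripled box. *)
Lemma gap_count (R : realType) (r N : nat) (v : 'I_r -> R[i]) (K : 'I_r -> nat)
    (B : pred R[i]) :
  (forall i, 3 * K i <= N)%N ->
  (#|[set g in box N K | B (lin_comb v (box_val g))]| * size (gap_seq N v K) <=
   size (seq.filter B (gap_seq N v K)) * \prod_(i < r) (6 * K i).+1)%N.
Proof.
move=> KN; rewrite /gap_seq.
pose W (g : {ffun 'I_r -> 'I_(N + N).+1}) := lin_comb v (box_val g).
set s := undup _; have Ws : s = undup [seq W g | g <- enum (box N K)] by [].
pose F := #|[set g in box N (fun i => 2 * K i)%N | W g == 0]|.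
have inj0 (U : {set {ffun 'I_r -> 'I_(N + N).+1}}) :
  {in U &, forall f g, box_val f =1 box_val g -> f = g}.
  by move=> f g _ _; apply: box_val_inj.
have fib z : (#|[set g in box N K | W g == z]| <= F)%N.
  case: (set_0Vmem [set g in box N K | W g == z]) => [->|[g0]]; first by rewrite cards0.
  rewrite inE => /andP[g0K /eqP g0z].
  apply: (card_le_shift (nv := @box_val r N) (s := fun i => - box_val g0 i)) => // g.
  rewrite inE => /andP[gK /eqP gz].
  have [|g' eg'] := @box_val_surj r N (fun i => box_val g i - box_val g0 i).
    by move=> i; have := mem_box_val gK i; have := mem_box_val g0K i; have := KN i; lia.
  exists g' => //; rewrite !inE /W (eq_lin_comb _ eg') lin_combB.
  rewrite -/(W g) -/(W g0) gz g0z subrr eqxx andbT.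
  apply/forallP => i; rewrite eg'.
  by have := mem_box_val gK i; have := mem_box_val g0K i; lia.
have le1 : (#|[set g in box N K | B (W g)]| <= size (seq.filter B s) * F)%N.
  rewrite -sum1_card.
  apply: (@leq_trans (\sum_(g in [set g in box N K | B (W g)])
     \sum_(z <- seq.filter B s) (W g == z))).
    apply: leq_sum => g; rewrite inE => /andP[gK gB].
    rewrite (big_rem (W g)) /= ?eqxx //.
    by rewrite mem_filter gB Ws mem_undup map_f ?mem_enum.
  rewrite exchange_big /=.
  apply: (@leq_trans (\sum_(z <- seq.filter B s) F)); last first.
    by rewrite big_const_seq count_predT iter_addn_0 mulnC.
  apply: leq_sum => z _; apply: leq_trans (fib z).
  rewrite -sum1_card [leqRHS]big_mkcond [leqLHS]big_mkcond /=.
  apply: leq_sum => g _; case: ifP => [|_]; last by case: ifP.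
  by rewrite finset.in_set => /andP[gK _]; rewrite finset.in_set gK /= -/(W g); case: (_ == z).
have le2 : (size s * F <= #|box N (fun i => 3 * K i)%N|)%N.
  apply: (@leq_trans (\sum_(z <- s) \sum_(g in box N (fun i => 3 * K i)%N) (W g == z))).
    rewrite mulnC -iter_addn_0 -(count_predT s) -big_const_seq.
    rewrite big_seq_cond [leqRHS]big_seq_cond; apply: leq_sum => z.
    rewrite andbT Ws mem_undup => /mapP[g0]; rewrite mem_enum => g0K ez.
    apply: (@leq_trans #|[set g in box N (fun i => 3 * K i)%N | W g == z]|).
      apply: (card_le_shift (nv := @box_val r N) (s := box_val g0)) => // g.
      rewrite inE => /andP[gK /eqP gz].
      have [|g' eg'] := @box_val_surj r N (fun i => box_val g i + box_val g0 i).
        by move=> i; have := mem_box_val gK i; have := mem_box_val g0K i; have := KN i; lia.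
      exists g' => //; rewrite !inE /W (eq_lin_comb _ eg') lin_combD.
      rewrite -/(W g) -/(W g0) gz ez add0r eqxx andbT.
      apply/forallP => i; rewrite eg'.
      by have := mem_box_val gK i; have := mem_box_val g0K i; lia.
    rewrite -sum1_card [leqRHS]big_mkcond [leqLHS]big_mkcond /=.
    apply: leq_sum => g _; case: ifP => [|//].
    by rewrite finset.in_set => /andP[-> /eqP ->]; rewrite eqxx.
  rewrite exchange_big /= -sum1_card; apply: leq_sum => g _.
  have : (count_mem (W g) s <= 1)%N by rewrite count_uniq_mem ?undup_uniq ?leq_b1.
  rewrite -sum1_count big_mkcond /=; apply: leq_trans.
  by apply: leq_sum => z _; rewrite eq_sym; case: (z == _).
apply: (@leq_trans (size (seq.filter B s) * F * size s)); first by rewrite leq_mul2r le1 orbT.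
rewrite -mulnA leq_mul2l; apply/orP; right; rewrite mulnC (leq_trans le2) //.
apply: leq_trans (card_box _ _) _.
by apply: leq_prod => i _; lia.
Qed.

Lemma symGAP_eq_gap_seq (R : realType) (r N : nat) (v : 'I_r -> R[i]) (M : 'I_r -> R) :
  (forall i, 0 <= M i) -> (forall i, Num.truncn (M i) <= N)%N ->
  symGAP v M = [set` gap_seq N v (fun i => Num.truncn (M i))].
Proof.
move=> M0 MN.
have MP i (n : int) : (`|n|%:~R <= M i) = (`|n|%N <= Num.truncn (M i))%N.
  by rewrite truncn_ge_nat // -abszE -pmulrn.
apply/seteqP; split=> z /=.
  case=> n nM ->; rewrite mem_undup; apply/mapP.
  have [|g gn] := @box_val_surj r N n.
    by move=> i; apply: leq_trans (MN i); rewrite -MP.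
  exists g; last by rewrite (eq_lin_comb v gn).
  by rewrite mem_enum inE; apply/forallP => i; rewrite gn -MP.
rewrite mem_undup => /mapP[g]; rewrite mem_enum => /mem_box_val gK ->.
by exists (box_val g) => // i; rewrite MP.
Qed.

Lemma card_fset_set_uniq (T : choiceType) (s : seq T) :
  uniq s -> #|` fset_set [set` s]| = size s.
Proof.
move=> us; have -> : [set` s] = [set` [fset x in s]%fset].
  by apply/seteqP; split=> x /=; rewrite inE.
by rewrite set_fsetK card_fseq undup_id.
Qed.

Lemma dispersion_gap_seq (R : realType) (r N : nat) (v : 'I_r -> R[i]) (M : 'I_r -> R) :
  (forall i, 0 <= M i) -> (forall i, Num.truncn (M i) <= N)%N ->
  let s := gap_seq N v (fun i => Num.truncn (M i)) in
  dispersion (symGAP v M) =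
    (size s)%:R / (size (seq.filter (fun z => cabs z <= 1) s))%:R.
Proof.
move=> M0 MN s; rewrite /dispersion (symGAP_eq_gap_seq v M0 MN) -/s.
rewrite card_fset_set_uniq ?undup_uniq //.
have -> : [set` s] `&` [set z | cabs z <= 1] =
    [set` seq.filter (fun z => cabs z <= 1) s].
  by apply/seteqP; split=> z /=; rewrite mem_filter; [case=> -> ->|case/andP].
by rewrite card_fset_set_uniq // filter_uniq // undup_uniq.
Qed.

Lemma gap_seq0 (R : realType) (r N : nat) (v : 'I_r -> R[i]) (K : 'I_r -> nat) :
  0 \in gap_seq N v K.
Proof.
rewrite mem_undup; apply/mapP; have [//|g g0] := @box_val_surj r N (fun=> 0).
exists g; first by rewrite mem_enum inE; apply/forallP => i; rewrite g0.
by rewrite (eq_lin_comb v g0) /lin_comb big1 // => i _; rewrite mul0r.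
Qed.

Lemma dispersion_ge1 (R : realType) (r : nat) (v : 'I_r -> R[i]) (M : 'I_r -> R) :
  (forall i, 0 <= M i) -> 1 <= dispersion (symGAP v M).
Proof.
move=> M0; pose N := \max_i Num.truncn (M i).
have MN i : (Num.truncn (M i) <= N)%N by apply: leq_bigmax.
rewrite (dispersion_gap_seq v M0 MN) ler_pdivlMr ?mul1r ?ler_nat.
  by rewrite size_filter count_size.
rewrite ltr0n size_filter -has_count; apply/hasP.
by exists 0; rewrite ?gap_seq0 // Normc.normc0.
Qed.

(** This is [gap_count] for the unit disk, with 6 K + 1 <= 6 (K + 1): up to a constant, the
    proportion of coefficient vectors with value in the disk is at most the proportion of elements
    of the progression there. *)
Lemma card_near_le_dispersion (R : realType) (r N : nat) (v : 'I_r -> R[i])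
    (M : 'I_r -> R) :
  (forall i, 0 <= M i) -> (forall i, 3 * Num.truncn (M i) <= N)%N ->
  #|[set g in box N (fun i => Num.truncn (M i)) |
      cabs (lin_comb v (box_val g)) <= 1]|%:R <=
  6 ^+ r * (\prod_(i < r) (Num.truncn (M i)).+1)%:R / dispersion (symGAP v M).
Proof.
move=> M0 MN; have MN' i : (Num.truncn (M i) <= N)%N by have := MN i; lia.
have D1 := dispersion_ge1 v M0.
rewrite ler_pdivlMr; last by apply: lt_le_trans D1.
rewrite (dispersion_gap_seq v M0 MN').
set s := gap_seq _ _ _.
have s0 : (0 : R) < (size (seq.filter (fun z => cabs z <= 1) s))%:R.
  rewrite ltr0n size_filter -has_count; apply/hasP.
  by exists 0; rewrite ?gap_seq0 // Normc.normc0.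
rewrite mulrA ler_pdivrMr // -natrX -!natrM ler_nat.
apply: leq_trans (gap_count v (fun z => cabs z <= 1) MN) _.
rewrite mulnC leq_mul2r; apply/orP; right.
have -> : (6 ^ r = \prod_(i < r) 6)%N by rewrite prod_nat_const card_ord.
rewrite -big_split /=; apply: leq_prod => i _; lia.
Qed.

(** * Sums over cells of the lattice and of the plane *)

Lemma sum_half_pow (R : realType) (n : nat) : \sum_(j < n) (2^-1 : R) ^+ j <= 2.
Proof.
suff -> : \sum_(j < n) (2^-1 : R) ^+ j = 2 - 2 * 2^-1 ^+ n.
  have : 0 <= (2^-1 : R) ^+ n by rewrite exprn_ge0.
  lra.
elim: n => [|n IH]; first by rewrite big_ord0 expr0; ring.
by rewrite big_ord_recr /= IH exprS; field.
Qed.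

(** For j >= 1 the term is at most (2/a) (1/j - 1/(j+1)), which telescopes; the induction therefore
    carries the remainder -(2/a)/(k+1). *)
Lemma sum_inv_quadratic (R : realType) (n : nat) (a : R) : 0 < a ->
  \sum_(j < n) (1 + a * j%:R ^+ 2)^-1 <= 1 + 2 / a.
Proof.
move=> a0.
have a2 : 0 < 2 / a by rewrite divr_gt0.
suff H k : \sum_(j < k.+1) (1 + a * j%:R ^+ 2)^-1 <= 1 + 2 / a - (2 / a) / k.+1%:R.
  case: n => [|n]; first by rewrite big_ord0; lra.
  by apply: le_trans (H n) _; rewrite gerBl divr_ge0 // ltW.
elim: k => [|k IH]; first by rewrite big_ord1 expr0n mulr0 addr0 mulr1n !invr1 mulr1; lra.
rewrite big_ord_recr /=; apply: le_trans (lerD IH (lexx _)) _.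
set x : R := k.+1%:R; have x1 : 1 <= x by rewrite ler1n.
have -> : k.+2%:R = x + 1 :> R by rewrite natr1.
suff : (1 + a * x ^+ 2)^-1 <= (2 / a) / x - (2 / a) / (x + 1).
  by move: (2 / a / x) (2 / a / (x + 1)) (_^-1) => p q w; lra.
have -> : (2 / a) / x - (2 / a) / (x + 1) = (a * x * (x + 1) / 2)^-1.
  by field; rewrite !gt_eqF //; lra.
have xx : x * (x + 1) / 2 <= x ^+ 2 by nra.
have p1 : 0 < a * x * (x + 1) / 2 by rewrite divr_gt0 // !mulr_gt0 //; lra.
rewrite lef_pV2 ?posrE //; last by have := sqr_ge0 x; nra.
by have := ler_wpM2l (ltW a0) xx; lra.
Qed.

(** The coordinates of the plane are indexed by a boolean so that products over a finite type, hence
    [prod_cos_expand], apply to them as to the lattice coordinates. *)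
Definition coord (R : realType) (e : bool) (z : R[i]) : R :=
  if e then complex.Im z else complex.Re z.

Lemma cabs_sqr (R : realType) (z : R[i]) :
  cabs z ^+ 2 = coord false z ^+ 2 + coord true z ^+ 2.
Proof. by case: z => a b; rewrite /= sqr_sqrtr // addr_ge0 // sqr_ge0. Qed.

Lemma cabs_ge0 (R : realType) (z : R[i]) : 0 <= cabs z.
Proof. by case: z => a b; rewrite sqrtr_ge0. Qed.

(** Since (1 - 1/m)^m <= 1/e <= 1/2, every complete block of m exponents halves the power. *)
Lemma one_sub_inv_pow (R : realType) (m : nat) (j : nat) : (0 < m)%N ->
  (1 - m%:R^-1 : R) ^+ j <= 2^-1 ^+ (j %/ m).
Proof.
move=> m0; have mR : 1 <= m%:R :> R by rewrite ler1n.
set rho : R := 1 - m%:R^-1.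
have i1 : m%:R^-1 <= 1 :> R by rewrite invf_le1 //; lra.
have i0 : 0 < m%:R^-1 :> R by rewrite invr_gt0; lra.
have r0 : 0 <= rho by rewrite /rho; lra.
have r1 : rho <= 1 by rewrite /rho; lra.
have hm : rho ^+ m <= 2^-1.
  apply: (@le_trans _ _ (expR (- m%:R^-1) ^+ m)).
    by apply: lerXn2r; rewrite ?nnegrE ?expR_ge0 //; apply: expR_ge1Dx.
  rewrite -expRM_natr mulNr mulVf ?gt_eqF //; last by lra.
  rewrite expRN lef_pV2 ?posrE ?expR_gt0 //.
  by apply: le_trans (expR_ge1Dx 1); lra.
rewrite {1}(divn_eq j m) exprD mulnC exprM.
apply: (@le_trans _ _ ((rho ^+ m) ^+ (j %/ m))).
  by rewrite ler_piMr ?exprn_ge0 // exprn_ile1.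
by apply: lerXn2r; rewrite ?nnegrE ?exprn_ge0.
Qed.

(** A cell of the line is a sign together with the modulus truncated in units of h; the sign keeps u
    and -u apart. *)
Lemma same_cell_dist (R : realType) (h u u' : R) : 0 < h ->
  (u < 0) = (u' < 0) -> Num.truncn (`|u| / h) = Num.truncn (`|u'| / h) ->
  `|u - u'| < h.
Proof.
move=> h0 es et.
have b (w : R) : (Num.truncn (`|w| / h))%:R * h <= `|w| < (Num.truncn (`|w| / h)).+1%:R * h.
  have /andP[h1 h2] : (Num.truncn (`|w| / h))%:R <= `|w| / h < (Num.truncn (`|w| / h)).+1%:R.
    by apply: truncn_itv; rewrite divr_ge0 // ltW.
  by rewrite -ler_pdivlMr // h1 -ltr_pdivrMr.
have := b u; have := b u'; rewrite -et -natr1.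
set q := (Num.truncn _)%:R => /andP[h1 h2] /andP[h3 h4].
have [u0|u0] := ltP u 0.
  have u'0 : u' < 0 by rewrite -es.
  move: h1 h2 h3 h4; rewrite (ltr0_norm u0) (ltr0_norm u'0) ltr_norml => *.
  by apply/andP; split; lra.
have u'0 : 0 <= u' by rewrite leNgt -es -leNgt.
move: h1 h2 h3 h4; rewrite (ger0_norm u0) (ger0_norm u'0) ltr_norml => *.
by apply/andP; split; lra.
Qed.

Lemma sum_le_cells (R : realType) (Y Ky : finType) (key : Y -> Ky) (F : Y -> R)
    (w : Ky -> R) (A : nat) :
  (forall f, F f <= w (key f)) -> (forall k, 0 <= w k) ->
  (forall k, #|[set f | key f == k]%SET| <= A)%N ->
  \sum_f F f <= (\sum_k w k) * A%:R.
Proof.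
move=> Fw w0 cA; apply: (@le_trans _ _ (\sum_f w (key f))); first exact: ler_sum.
rewrite (partition_big key xpredT) //= mulr_suml; apply: ler_sum => k _.
rewrite (eq_bigr (fun=> w k)) => [|f /eqP -> //].
rewrite sumr_const -[leLHS]mulr_natr ler_wpM2l ?w0 // ler_nat.
apply: leq_trans (cA k); apply: eq_leq; apply: eq_card => f.
by rewrite finset.in_set.
Qed.

(** The weights factor over the coordinates, so the sum is a product of one-dimensional sums. A
    lattice coordinate gives 2/(K+1) times two signs times a geometric sum of at most 2; a plane
    coordinate gives 2 times two signs times the quadratic sum. *)
Lemma cell_weight_sum (R : realType) (r N Q : nat) (K : 'I_r -> nat) (a : R) : 0 < a ->
  \sum_(k : {ffun 'I_r -> bool * 'I_N} * {ffun bool -> bool * 'I_Q})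
    (\prod_i (2 / (K i).+1%:R * 2^-1 ^+ (k.1 i).2)) *
    (\prod_e (2 * (1 + a * (k.2 e).2%:R ^+ 2)^-1)) <=
  8 ^+ r / (\prod_(i < r) (K i).+1)%:R * (4 * (1 + 2 / a)) ^+ 2.
Proof.
move=> a0.
rewrite -(pair_bigA _ (fun (k1 : {ffun 'I_r -> bool * 'I_N}) (k2 : {ffun bool -> bool * 'I_Q}) =>
    (\prod_i (2 / (K i).+1%:R * 2^-1 ^+ (k1 i).2)) *
    (\prod_e (2 * (1 + a * (k2 e).2%:R ^+ 2)^-1)))) /=.
rewrite -big_distrlr /=.
rewrite -(bigA_distr_bigA (fun i (p : bool * 'I_N) => 2 / (K i).+1%:R * 2^-1 ^+ p.2)).
rewrite -(bigA_distr_bigA (fun (e : bool) (p : bool * 'I_Q) => 2 * (1 + a * p.2%:R ^+ 2)^-1)).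
have s1 i : 0 <= \sum_(p : bool * 'I_N) (2 / (K i).+1%:R * 2^-1 ^+ p.2 : R) <= 8 / (K i).+1%:R.
  have k0 : 0 < (K i).+1%:R^-1 :> R by rewrite invr_gt0 ltr0n.
  rewrite sumr_ge0 /= => [|p _]; last by rewrite !mulr_ge0 ?exprn_ge0 // ltW.
  rewrite -mulr_sumr -(pair_bigA _ (fun b (j : 'I_N) => 2^-1 ^+ j)) /= big_bool /=.
  have := sum_half_pow R N; have : 0 <= \sum_(j < N) (2^-1 : R) ^+ j.
    by rewrite sumr_ge0 // => j _; rewrite exprn_ge0.
  move: (\sum_(j < N) _) => S S0 S2.
  by move: ((K i).+1%:R^-1) k0 => q q0; nra.
have s2 : 0 <= \sum_(p : bool * 'I_Q) (2 * (1 + a * p.2%:R ^+ 2)^-1) <= 4 * (1 + 2 / a).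
  rewrite sumr_ge0 /= => [|p _]; last first.
    by rewrite mulr_ge0 // invr_ge0 addr_ge0 // mulr_ge0 ?sqr_ge0 // ltW.
  rewrite -mulr_sumr -(pair_bigA _ (fun b (j : 'I_Q) => (1 + a * j%:R ^+ 2)^-1)) /= big_bool /=.
  by have := sum_inv_quadratic Q a0; lra.
apply: ler_pM.
- by rewrite prodr_ge0 // => i _; case/andP: (s1 i).
- by rewrite prodr_ge0 // => i _; case/andP: s2.
- apply: (@le_trans _ _ (\prod_(i < r) (8 / (K i).+1%:R))); first exact: ler_prod.
  by rewrite big_split /= prodr_const card_ord prodfV natr_prod.
case/andP: s2 => s20 s21; rewrite big_bool /= -expr2.
by apply: lerXn2r; rewrite ?nnegrE //; apply: le_trans s21.
Qed.

Lemma absz_sub_same_div (m j j0 : nat) : (0 < m)%N -> (j %/ m = j0 %/ m)%N ->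
  (absz (j%:Z - j0%:Z) < m)%N.
Proof.
move=> m0 e; have := ltn_pmod j m0; have := ltn_pmod j0 m0.
have := divn_eq j m; have := divn_eq j0 m; rewrite e.
move: (j0 %/ m * m)%N (j %% m)%N (j0 %% m)%N => X b b0; lia.
Qed.

(* Two indices in the same cell differ by an element of the box K whose value lies in
   the unit disk, so every cell has at most as many indices as the cardinal below. *)
Lemma lattice_sum_le (R : realType) (r N N' : nat) (v : 'I_r -> R[i]) (K : 'I_r -> nat)
    (d : 'I_r -> nat -> R) (G : R -> R) (U c : R) (y : R[i]) :
  0 < c -> c <= cabs y ->
  (forall i j, 0 <= d i j <= 2 / (K i).+1%:R * (1 - (K i).+1%:R^-1) ^+ j) ->
  (forall u, `|u| <= U -> 0 <= G u <= 2 * (1 + u ^+ 2 / 4)^-1) ->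
  (forall (f : {ffun 'I_r -> bool * 'I_N}) e,
    `|coord e (y * lin_comb v (fun i => signed_val (f i)))| <= U) ->
  (forall i, K i <= N')%N ->
  \sum_(f : {ffun 'I_r -> bool * 'I_N}) (\prod_i d i (f i).2) *
     \prod_e G (coord e (y * lin_comb v (fun i => signed_val (f i)))) <=
  8 ^+ r / (\prod_(i < r) (K i).+1)%:R * (4 * (1 + 2 / (c ^+ 2 / 16))) ^+ 2 *
  #|[set g in box N' K | cabs (lin_comb v (box_val g)) <= 1]|%:R.
Proof.
(* If two points of the plane lie in the same cell of side c/2, both coordinates of their difference
   are below c/2, so its modulus is below c <= |y|; dividing by y lands in the unit disk. *)
move=> c0 cy dK GU fU KN; pose h := c / 2.
have h0 : 0 < h by rewrite divr_gt0.
pose W (f : {ffun 'I_r -> bool * 'I_N}) := lin_comb v (fun i => signed_val (f i)).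
pose Q := (Num.truncn (U / h)).+1.
pose q e f : 'I_Q := inord (Num.truncn (`|coord e (y * W f)| / h)).
have qE e f : q e f = Num.truncn (`|coord e (y * W f)| / h) :> nat.
  rewrite /q inordK // ltnS; apply: le_truncn.
  by rewrite ler_pM2r ?invr_gt0 //; apply: fU.
(* Blocks of length K+1 match the decay scale of the coefficients, and two indices of equal sign in
   one block differ by at most K. *)
pose key1 (f : {ffun 'I_r -> bool * 'I_N}) : {ffun 'I_r -> bool * 'I_N.+1} :=
  [ffun i => ((f i).1, inord ((f i).2 %/ (K i).+1))].
have k1E f i : (key1 f i).2 = ((f i).2 %/ (K i).+1)%N :> nat.
  by rewrite ffunE /= inordK // ltnS (leq_trans (leq_div _ _)) // ltnW.
pose key2 f : {ffun bool -> bool * 'I_Q} := [ffun e => (coord e (y * W f) < 0, q e f)].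
(* In the plane cell number t one has |u| >= t c / 2, hence u^2 / 4 >= a t^2. *)
pose a := c ^+ 2 / 16; have a0 : 0 < a by rewrite divr_gt0 // exprn_gt0.
apply: le_trans (ler_wpM2r _ (@cell_weight_sum R r N.+1 Q K a a0)); last by rewrite ler0n.
apply: (sum_le_cells (key := fun f => (key1 f, key2 f))).
- move=> f /=; apply: ler_pM.
  + by rewrite prodr_ge0 // => i _; case/andP: (dK i (f i).2).
  + by rewrite prodr_ge0 // => e _; case/andP: (GU _ (fU f e)).
  + apply: ler_prod => i _; case/andP: (dK i (f i).2) => -> /= h1.
    apply: le_trans h1 _; rewrite k1E ler_wpM2l ?divr_ge0 //.
    exact: one_sub_inv_pow.
  + apply: ler_prod => e _; case/andP: (GU _ (fU f e)) => -> /= h1.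
    apply: le_trans h1 _; rewrite ler_wpM2l // ffunE /= qE.
    set u := coord _ _; set t := Num.truncn _.
    have tu : t%:R * h <= `|u|.
      by rewrite -ler_pdivlMr // truncn_le // divr_ge0 // ltW.
    have : (t%:R * h) ^+ 2 <= u ^+ 2.
      rewrite -(real_normK (num_real u)); apply: lerXn2r; rewrite ?nnegrE //.
      by rewrite mulr_ge0 // ltW.
    have ap : 0 <= a * t%:R ^+ 2 by rewrite mulr_ge0 ?sqr_ge0 // ltW.
    have up := sqr_ge0 u.
    rewrite lef_pV2 ?posrE; [|lra|lra].
    by rewrite /h /a exprMn; lra.
- move=> k; apply: mulr_ge0; apply: prodr_ge0 => i _.
    by rewrite mulr_ge0 ?divr_ge0 ?exprn_ge0.
  by rewrite mulr_ge0 // invr_ge0 addr_ge0 // mulr_ge0 ?sqr_ge0 // ltW.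
move=> k.
case: (set_0Vmem [set f | (key1 f, key2 f) == k]%SET) => [->|[f0]]; first by rewrite cards0.
rewrite inE => /eqP kf0.
have kP f : f \in [set f | (key1 f, key2 f) == k]%SET -> key1 f = key1 f0 /\ key2 f = key2 f0.
  by rewrite inE -kf0 => /eqP[-> ->].
apply: (card_le_shift (nv := fun (f : {ffun 'I_r -> bool * 'I_N}) i => signed_val (f i))
  (s := fun i => - signed_val (f0 i))).
  move=> f g /kP[kf _] /kP[kg _] e; apply/ffunP => i.
  have := e i; have : (f i).1 = (g i).1.
    have := congr1 (fun k : {ffun 'I_r -> bool * 'I_N.+1} => (k i).1) (etrans kf (esym kg)).
    by rewrite !ffunE.
  case: (f i) (g i) => [s j] [s' j']; rewrite /signed_val /= => <- ejj.
  congr (_, _); apply: val_inj => /=; case: (s) ejj; lia.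
move=> f /kP[kf1 kf2].
have df i : (`|signed_val (f i) - signed_val (f0 i)| <= K i)%N.
  have es : (f i).1 = (f0 i).1.
    by have := congr1 (fun k : {ffun 'I_r -> bool * 'I_N.+1} => (k i).1) kf1; rewrite !ffunE.
  have ed : ((f i).2 %/ (K i).+1 = (f0 i).2 %/ (K i).+1)%N by rewrite -!k1E kf1.
  have := absz_sub_same_div (ltn0Sn (K i)) ed.
  by rewrite /signed_val es; case: (f0 i).1 => /=; lia.
have [|g gE] := @box_val_surj r N' (fun i => signed_val (f i) - signed_val (f0 i)).
  by move=> i; apply: leq_trans (df i) (KN i).
exists g => //; rewrite finset.in_set; apply/andP; split.
  by rewrite finset.in_set; apply/forallP => i; rewrite gE.
rewrite (eq_lin_comb v gE) lin_combB -/(W f) -/(W f0).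
have dc e : `|coord e (y * (W f - W f0))| < h.
  have -> : coord e (y * (W f - W f0)) = coord e (y * W f) - coord e (y * W f0).
    by rewrite mulrBr; case: (y * W f) (y * W f0) => ? ? [? ?]; case: e.
  apply: same_cell_dist => //.
    by have := congr1 (fun k : {ffun bool -> bool * 'I_Q} => (k e).1) kf2; rewrite !ffunE.
  have := congr1 (fun k : {ffun bool -> bool * 'I_Q} => (k e).2 : nat) kf2.
  by rewrite !ffunE /= !qE.
have : cabs (y * (W f - W f0)) ^+ 2 <= cabs y ^+ 2.
  apply: (@le_trans _ _ (c ^+ 2)); last by rewrite lerXn2r // ?nnegrE ?cabs_ge0 // ltW.
  rewrite cabs_sqr.
  have sq e : coord e (y * (W f - W f0)) ^+ 2 <= h ^+ 2.
    rewrite -(real_normK (num_real (coord _ _))) lerXn2r ?nnegrE ?(ltW h0) //.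
    exact: ltW (dc e).
  have := sq true; have := sq false; rewrite /h exprMn.
  have := sqr_ge0 c; lra.
rewrite Normc.normcM exprMn.
have y0 : 0 < cabs y by apply: lt_le_trans cy.
rewrite ger_pMr ?exprn_gt0 // expr_le1 //; exact: cabs_ge0.
Qed.

(** * Summing the cosines back: from Poisson kernels to the dispersion *)

Lemma pkernel_ge0 (R : realType) (m : nat) (t : R) : (0 < m)%N -> 0 <= pkernel m t.
Proof.
move=> m0; have mR : 1 <= m%:R :> R by rewrite ler1n.
have ct := cos_le1 t; rewrite invr_ge0 addr_ge0 // !mulr_ge0 //; lra.
Qed.

Lemma coord_le_cabs (R : realType) (e : bool) (z : R[i]) : `|coord e z| <= cabs z.
Proof.
rewrite -(@ler_pXn2r _ 2) ?nnegrE ?cabs_ge0 // real_normK ?num_real // cabs_sqr.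
by case: e; rewrite ?lerDl ?lerDr sqr_ge0.
Qed.

(** The phase that appears when a product of two cosine sums, one in each coordinate of the plane,
    is expanded; k is the frequency vector and Lam the common scale. *)
Definition plane_form (R : realType) (Lam : R) (N : nat)
    (k : {ffun bool -> bool * 'I_N}) (z : R[i]) : R :=
  \sum_e (signed_val (k e))%:~R * (coord e z / Lam).

Lemma coordD (R : realType) (e : bool) (z w : R[i]) :
  coord e (z + w) = coord e z + coord e w.
Proof. by case: e z w => -[? ?] [? ?]. Qed.

Lemma coordZ (R : realType) (e : bool) (n : int) (z : R[i]) :
  coord e (n%:~R * z) = n%:~R * coord e z.
Proof.
rewrite -(rmorph_int (@real_complex R)); case: e z => -[a b] /=.
  by rewrite mul0r addr0.
by rewrite mul0r subr0.
Qed.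

(** The duality behind the exchange of sums: a phase in the lattice frequencies n, for fixed k, is
    also a phase in the plane frequencies k, for fixed n. *)
Lemma plane_form_lin (R : realType) (Lam : R) (N r : nat)
    (k : {ffun bool -> bool * 'I_N}) (y : R[i]) (v : 'I_r -> R[i]) (n : 'I_r -> int) :
  \sum_i (n i)%:~R * plane_form Lam k (y * v i) = plane_form Lam k (y * lin_comb v n).
Proof.
rewrite /plane_form; under eq_bigr do rewrite mulr_sumr.
rewrite exchange_big /=; apply: eq_bigr => e _.
have -> : coord e (y * lin_comb v n) = \sum_i (n i)%:~R * coord e (y * v i).
  rewrite /lin_comb mulr_sumr (big_morph (coord e) (id1 := 0) (op1 := +%R) (@coordD R e)).
    by apply: eq_bigr => i _; rewrite mulrCA coordZ.
  by case: e.
by rewrite mulr_suml mulr_sumr; apply: eq_bigr => i _; ring.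
Qed.

(** The order of choices matters. Truncating the r kernels leaves finitely many lattice points;
    their values, for |y| <= Y, fit in a window U; the Gaussian majorant is then built for that
    window. Thus [Lam], [N] and [d] do not depend on y. *)
Lemma poisson_sum_dispersion (R : realType) (r : nat) (v : 'I_r -> R[i]) (M : 'I_r -> R)
    (c Y : R) :
  (forall i, 0 <= M i) -> 0 < c ->
  exists (Lam : R) (N : nat) (d : nat -> R), [/\
    forall j, 0 <= d j,
    forall u, expR (- u ^+ 2) <= 2 * \sum_(j < N) d j * cos (j%:R * (u / Lam)) &
    forall y, c <= cabs y <= Y ->
      \sum_(k : {ffun bool -> bool * 'I_N}) (\prod_e d (k e).2) *
        \prod_i pkernel (Num.truncn (M i)).+1 (plane_form Lam k (y * v i)) <=
      48 ^+ r * (4 * (1 + 2 / (c ^+ 2 / 16))) ^+ 2 / dispersion (symGAP v M)].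
Proof.
move=> M0 c0; pose K i := Num.truncn (M i).
(* Taking delta = 1/(K+1) only doubles the coefficients, to the bound 2/(K+1) that [lattice_sum_le]
   asks for. *)
have /fin_all_exists[N0 HN0] : forall i : 'I_r, exists N0, forall N, (N0 <= N)%N ->
  exists d : nat -> R, [/\
    forall j, 0 <= d j <= ((K i).+1%:R^-1 + (K i).+1%:R^-1) * (1 - (K i).+1%:R^-1) ^+ j &
    forall t : R, pkernel (K i).+1 t <= 2 * \sum_(j < N) d j * cos (j%:R * t) <=
        pkernel (K i).+1 t + (K i).+1%:R^-1].
  by move=> i; apply: pkernel_trunc => //; rewrite invr_gt0 ltr0n.
pose N1 := \max_i N0 i.
have /fin_all_exists[d1 Hd1] i := HN0 i N1 (leq_bigmax i).
pose W (f : {ffun 'I_r -> bool * 'I_N1}) := lin_comb v (fun i => signed_val (f i)).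
pose U := Y * \sum_f cabs (W f).
have [Lam [N [d [Lam0 d0 dge dle]]]] := gauss_cos_majorant U.
exists Lam, N, d; split=> // y /andP[cy yY].
have fU f e : `|coord e (y * W f)| <= U.
  apply: le_trans (coord_le_cabs _ _) _; rewrite Normc.normcM.
  apply: ler_pM; rewrite ?cabs_ge0 // (bigD1 f) //= lerDl sumr_ge0 // => g _.
  exact: cabs_ge0.
pose N' := \max_i (3 * K i)%N.
have KN i : (3 * K i <= N')%N by apply: (leq_bigmax (F := fun i => 3 * K i)%N).
pose G u := 2 * \sum_(j < N) d j * cos (j%:R * (u / Lam)).
have := @lattice_sum_le R r N1 N' v K d1 G U c y c0 cy.
move=> /(_ _ _ fU) H.
apply: le_trans (_ : _ <= \sum_(f : {ffun 'I_r -> bool * 'I_N1})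
  (\prod_i d1 i (f i).2) * \prod_e G (coord e (y * W f))) _.
  apply: (@le_trans _ _ (\sum_(k : {ffun bool -> bool * 'I_N}) (\prod_e d (k e).2) *
     \prod_i (2 * \sum_(j < N1) d1 i j * cos (j%:R * plane_form Lam k (y * v i))))).
    apply: ler_sum => k _; apply: ler_wpM2l; first by rewrite prodr_ge0.
    apply: ler_prod => i _; rewrite pkernel_ge0 //=.
    by have [_ /(_ (plane_form Lam k (y * v i)))/andP[]] := Hd1 i.
  (* Here equality holds: both sides expand into the same double sum over k and f of coefficients
     times the cosine of one phase. *)
  rewrite le_eqVlt; apply/orP; left; apply/eqP.
  under eq_bigr do rewrite prod_cos_expand mulr_sumr.
  rewrite exchange_big /=; apply: eq_bigr => f _.
  rewrite /G (prod_cos_expand N (fun=> d) (fun e => coord e (y * W f) / Lam)) mulr_sumr.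
  by apply: eq_bigr => k _; rewrite mulrCA plane_form_lin.
apply: le_trans (H _ _ _) _.
- by move=> i j; have [/(_ j) h _] := Hd1 i; rewrite [2 / _]mulr_natl mulr2n.
- by move=> u uU; rewrite dle // andbT; apply: le_trans (dge u); apply: expR_ge0.
- by move=> i; have := KN i; lia.
have := @card_near_le_dispersion R r N' v M M0 KN; rewrite -/K.
set A := _%:R; set Pm := (\prod_(i < r) _)%:R => hA.
have Pm0 : 0 < Pm by rewrite ltr0n prodn_gt0.
set X := _ ^+ 2; have X0 : 0 <= X by rewrite sqr_ge0.
have -> : 48 ^+ r * X / dispersion (symGAP v M) =
    8 ^+ r / Pm * X * (6 ^+ r * Pm / dispersion (symGAP v M)).
  have -> : 48 = 8 * 6 :> R by rewrite -natrM.
  have D0 : dispersion (symGAP v M) != 0.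
    by rewrite gt_eqF // (lt_le_trans _ (dispersion_ge1 v M0)).
  by rewrite exprMn; field; rewrite D0 gt_eqF.
apply: ler_wpM2l hA; apply: mulr_ge0 => //.
by rewrite divr_ge0 ?exprn_ge0 // ltW.
Qed.

(** * Expectations and independence of bounded random variables *)

Definition bounded_rv (R : realType) (d : measure_display) (T : measurableType d)
    (f : T -> R) : Prop :=
  measurable_fun [set: T] f /\ exists B, forall t, `|f t| <= B.

(** A real-valued mean, used for bounded measurable functions, where it agrees with the
    extended-real expectation. *)
Definition Ex (R : realType) (d : measure_display) (T : measurableType d)
    (P : probability T R) (f : T -> R) : R := \int[P]_t f t.

Lemma bounded_rv_integrable (R : realType) (d : measure_display) (T : measurableType d)
    (P : probability T R) (f : T -> R) :
  bounded_rv f -> P.-integrable [set: T] (EFin \o f).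
Proof.
move=> [mf [B fB]]; apply: measurable_bounded_integrable => //.
  exact: le_lt_trans (probability_le1 P measurableT) (ltry 1).
exists B; split; first exact: num_real.
by move=> x xB t _; apply: le_trans (fB t) (ltW xB).
Qed.

Lemma expectation_Ex (R : realType) (d : measure_display) (T : measurableType d)
    (P : probability T R) (f : T -> R) :
  bounded_rv f -> ('E_P[f] = (Ex P f)%:E)%E.
Proof.
move=> bf; rewrite unlock /Ex /Rintegral fineK //.
exact: integrable_fin_num (bounded_rv_integrable P bf).
Qed.

Lemma bounded_rv_cst (R : realType) (d : measure_display) (T : measurableType d) (c : R) :
  bounded_rv (fun _ : T => c).
Proof. by split; [exact: measurable_cst|exists `|c|]. Qed.

Lemma bounded_rvD (R : realType) (d : measure_display) (T : measurableType d)
    (f g : T -> R) : bounded_rv f -> bounded_rv g -> bounded_rv (fun t => f t + g t).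
Proof.
move=> [mf [A fA]] [mg [B gB]]; split; first exact: measurable_funD.
by exists (A + B) => t; apply: le_trans (ler_normD _ _) (lerD (fA t) (gB t)).
Qed.

Lemma bounded_rvM (R : realType) (d : measure_display) (T : measurableType d)
    (f g : T -> R) : bounded_rv f -> bounded_rv g -> bounded_rv (fun t => f t * g t).
Proof.
move=> [mf [A fA]] [mg [B gB]]; split; first exact: measurable_funM.
by exists (A * B) => t; rewrite normrM ler_pM.
Qed.

Lemma bounded_rvZ (R : realType) (d : measure_display) (T : measurableType d)
    (c : R) (f : T -> R) : bounded_rv f -> bounded_rv (fun t => c * f t).
Proof. exact: bounded_rvM (bounded_rv_cst _ c). Qed.

Lemma bounded_rvB (R : realType) (d : measure_display) (T : measurableType d)
    (f g : T -> R) : bounded_rv f -> bounded_rv g -> bounded_rv (fun t => f t - g t).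
Proof.
move=> bf [mg [B gB]]; apply: bounded_rvD bf _; split; first exact: measurableT_comp.
by exists B => t; rewrite normrN.
Qed.

Lemma bounded_rv_sum (R : realType) (d : measure_display) (T : measurableType d)
    (I : Type) (s : seq I) (f : I -> T -> R) :
  (forall i, bounded_rv (f i)) -> bounded_rv (fun t => \sum_(i <- s) f i t).
Proof.
move=> bf; elim: s => [|i s IH].
  by under eq_fun do rewrite big_nil; exact: bounded_rv_cst.
by under eq_fun do rewrite big_cons; exact: bounded_rvD.
Qed.

Lemma bounded_rv_prod (R : realType) (d : measure_display) (T : measurableType d)
    (I : Type) (s : seq I) (Q : pred I) (f : I -> T -> R) :
  (forall i, bounded_rv (f i)) -> bounded_rv (fun t => \prod_(i <- s | Q i) f i t).
Proof.
move=> bf; elim: s => [|i s IH].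
  by under eq_fun do rewrite big_nil; exact: bounded_rv_cst.
under eq_fun do rewrite big_cons; case: (Q i) => //; exact: bounded_rvM.
Qed.

Lemma bounded_rv_indic (R : realType) (d : measure_display) (T : measurableType d)
    (A : set T) : measurable A -> bounded_rv (\1_A : T -> R).
Proof.
move=> mA; split; first exact: measurable_indic.
by exists 1 => t; rewrite indicE; case: (_ \in _); rewrite ?normr1 ?normr0.
Qed.

Lemma ExD (R : realType) (d : measure_display) (T : measurableType d)
    (P : probability T R) (f g : T -> R) : bounded_rv f -> bounded_rv g ->
  Ex P (fun t => f t + g t) = Ex P f + Ex P g.
Proof. by move=> bf bg; apply: RintegralD => //; apply: bounded_rv_integrable. Qed.

Lemma ExB (R : realType) (d : measure_display) (T : measurableType d)
    (P : probability T R) (f g : T -> R) : bounded_rv f -> bounded_rv g ->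
  Ex P (fun t => f t - g t) = Ex P f - Ex P g.
Proof. by move=> bf bg; apply: RintegralB => //; apply: bounded_rv_integrable. Qed.

Lemma ExZ (R : realType) (d : measure_display) (T : measurableType d)
    (P : probability T R) (c : R) (f : T -> R) : bounded_rv f ->
  Ex P (fun t => c * f t) = c * Ex P f.
Proof. by move=> bf; apply: RintegralZl => //; apply: bounded_rv_integrable. Qed.

Lemma Ex_cst (R : realType) (d : measure_display) (T : measurableType d)
    (P : probability T R) (c : R) : Ex P (fun=> c) = c.
Proof.
by rewrite /Ex Rintegral_cst //; have /= -> := probability_setT P; rewrite mulr1.
Qed.

Lemma Ex_sum (R : realType) (d : measure_display) (T : measurableType d)
    (P : probability T R) (I : Type) (s : seq I) (f : I -> T -> R) :
  (forall i, bounded_rv (f i)) ->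
  Ex P (fun t => \sum_(i <- s) f i t) = \sum_(i <- s) Ex P (f i).
Proof.
move=> bf; elim: s => [|i s IH].
  by rewrite big_nil; under eq_fun do rewrite big_nil; exact: Ex_cst.
rewrite big_cons -IH; under eq_fun do rewrite big_cons.
by apply: ExD => //; apply: bounded_rv_sum.
Qed.

Lemma Ex_le (R : realType) (d : measure_display) (T : measurableType d)
    (P : probability T R) (f g : T -> R) : bounded_rv f -> bounded_rv g ->
  (forall t, f t <= g t) -> Ex P f <= Ex P g.
Proof.
by move=> bf bg fg; apply: le_Rintegral => //; apply: bounded_rv_integrable.
Qed.

Lemma Ex_indic (R : realType) (d : measure_display) (T : measurableType d)
    (P : probability T R) (A : set T) : measurable A -> (Ex P \1_A)%:E = P A.
Proof.
move=> mA; rewrite -expectation_Ex; last exact: bounded_rv_indic.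
by rewrite unlock integral_indic // setIT.
Qed.

Lemma Ex_norm_le (R : realType) (d : measure_display) (T : measurableType d)
    (P : probability T R) (f : T -> R) (B : R) : bounded_rv f ->
  (forall t, `|f t| <= B) -> `|Ex P f| <= B.
Proof.
move=> bf fB; rewrite ler_norml -{1}(Ex_cst P (- B)) -{2}(Ex_cst P B).
by apply/andP; split; apply: Ex_le => //; try exact: bounded_rv_cst;
  move=> t; have := fB t; rewrite ler_norml => /andP[].
Qed.

(* X is a uniform limit of combinations of indicators of its level sets. *)
Lemma Ex_orth_level_sets (R : realType) (d : measure_display) (T : measurableType d)
    (P : probability T R) (X Z : T -> R) : bounded_rv X -> bounded_rv Z ->
  (forall B : set R, measurable B -> Ex P (fun t => \1_B (X t) * Z t) = 0) ->
  Ex P (fun t => X t * Z t) = 0.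
Proof.
move=> bX bZ H; have [mX [b0 Xb0]] := bX; have [mZ [c0 Zc0]] := bZ.
pose b := `|b0| + 1; pose c := `|c0| + 1.
have bp : 0 < b by rewrite ltr_wpDl.
have cp : 0 < c by rewrite ltr_wpDl.
have Xb t : `|X t| <= b.
  by apply: le_trans (Xb0 t) _; apply: le_trans (ler_norm _) _; rewrite lerDl.
have Zc t : `|Z t| <= c.
  by apply: le_trans (Zc0 t) _; apply: le_trans (ler_norm _) _; rewrite lerDl.
suff HN (N : nat) : (0 < N)%N -> `|Ex P (fun t => X t * Z t)| <= (2 * b * c) / N%:R.
  apply/eqP; rewrite -normr_le0; apply/ler_addgt0Pr => e e0; rewrite add0r.
  pose N := (Num.truncn (2 * b * c / e)).+1.
  apply: le_trans (HN N isT) _; rewrite ler_pdivrMr ?ltr0n //.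
  have := truncnS_gt (2 * b * c / e); rewrite ltr_pdivrMr // => /ltW h.
  by rewrite [e * _]mulrC.
move=> N0; have NR : 0 < N%:R :> R by rewrite ltr0n.
pose step := 2 * b / N%:R; have st0 : 0 < step by rewrite divr_gt0 // mulr_gt0.
(* There are N + 1 half-open intervals of length 2b/N; the extra one catches the value X = b. *)
pose B (l : 'I_N.+1) : set R := [set` `[- b + l%:R * step, - b + l.+1%:R * step[%R].
have mB l : measurable (B l) by exact: measurable_itv.
pose g t := \sum_(l < N.+1) (- b + l%:R * step) * (\1_(B l) (X t) * Z t).
have bI l : bounded_rv (fun t => \1_(B l) (X t) * Z t).
  apply: bounded_rvM bZ.
  have -> : (fun t => \1_(B l) (X t)) = (\1_(X @^-1` B l) : T -> R) by [].
  by apply: bounded_rv_indic; rewrite -[_ @^-1` _]setTI; apply: mX.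
have bg : bounded_rv g.
  by apply: bounded_rv_sum => l; apply: bounded_rvZ.
have Eg : Ex P g = 0.
  rewrite Ex_sum => [|l]; last exact: bounded_rvZ.
  by rewrite big1 // => l _; rewrite ExZ // H // mulr0.
have -> : Ex P (fun t => X t * Z t) = Ex P (fun t => X t * Z t - g t).
  by rewrite ExB ?Eg ?subr0 //; exact: bounded_rvM.
apply: Ex_norm_le; first by apply: bounded_rvB => //; exact: bounded_rvM.
move=> t; pose s := (X t + b) / step.
have /andP[Xl Xu] : - b <= X t <= b by rewrite -ler_norml.
have s0 : 0 <= s by apply: divr_ge0; [lra|rewrite ltW].
have /andP[s1 s2] := truncn_itv s0.
have sN : (Num.truncn s < N.+1)%N.
  rewrite ltnS -(ler_nat R); apply: le_trans s1 _.
  rewrite /s ler_pdivrMr // /step mulrCA divff ?gt_eqF // mulr1; lra.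
pose l0 := Ordinal sN.
have inB (l : 'I_N.+1) : (X t \in B l) = (l == l0).
  apply/idP/idP => [|/eqP ->]; last first.
    rewrite inE /B /= in_itv /= -lerBrDl -ltrBlDl opprK -ler_pdivlMr // -ltr_pdivrMr //.
    by rewrite s1 s2.
  rewrite inE /B /= in_itv /= -lerBrDl -ltrBlDl opprK -ler_pdivlMr // -ltr_pdivrMr //.
  by move=> h; apply/eqP/val_inj => /=; apply/esym/eqP; rewrite truncn_eq.
have -> : g t = (- b + l0%:R * step) * Z t.
  rewrite /g (bigD1 l0) //= big1 => [|l /negPf ll0].
    by rewrite indicE inB eqxx mul1r addr0.
  by rewrite indicE inB ll0 mul0r mulr0.
rewrite -mulrBl normrM mulrAC; apply: ler_pM => //; rewrite -/step.
have -> : X t - (- b + l0%:R * step) = (s - l0%:R) * step.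
  by rewrite mulrBl /s divfK ?gt_eqF //; ring.
rewrite normrM (gtr0_norm st0) ger_pMl // ger0_norm /=; last by rewrite subr_ge0.
by move: s2; rewrite -natr1; lra.
Qed.

Lemma bounded_rv_comp (R : realType) (d d' : measure_display) (T : measurableType d)
    (E : measurableType d') (X : T -> E) (F : E -> R) :
  measurable_fun [set: T] X -> bounded_rv F -> bounded_rv (fun t => F (X t)).
Proof.
move=> mX [mF [B FB]]; split; last by exists B => t.
exact: measurableT_comp.
Qed.

Lemma bounded_rv_level (R : realType) (d : measure_display) (T : measurableType d)
    (X : T -> R) (B : set R) :
  bounded_rv X -> measurable B -> bounded_rv (fun t => \1_B (X t) : R).
Proof. by move=> [mX _] mB; apply: bounded_rv_comp => //; apply: bounded_rv_indic. Qed.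

Lemma Ex_level (R : realType) (d : measure_display) (T : measurableType d)
    (P : probability T R) (X : T -> R) (B : set R) :
  bounded_rv X -> measurable B -> (Ex P (fun t => \1_B (X t)))%:E = P (X @^-1` B).
Proof.
move=> [mX _] mB; rewrite -Ex_indic //.
by rewrite -[_ @^-1` _]setTI; apply: mX.
Qed.

(** The product rule is given for indicators. [Ex_orth_level_sets], applied to one factor while the
    other is centred at its mean, extends it to bounded functions, first in Y and then in X. *)
Lemma Ex_indep2 (R : realType) (d : measure_display) (T : measurableType d)
    (P : probability T R) (X Y : T -> R) : bounded_rv X -> bounded_rv Y ->
  (forall A B : set R, measurable A -> measurable B ->
     P ((X @^-1` A) `&` (Y @^-1` B)) = (P (X @^-1` A) * P (Y @^-1` B))%E) ->
  Ex P (fun t => X t * Y t) = Ex P X * Ex P Y.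
Proof.
move=> bX bY H.
have HAB A B : measurable A -> measurable B ->
    Ex P (fun t => \1_B (Y t) * \1_A (X t)) =
    Ex P (fun t => \1_B (Y t)) * Ex P (fun t => \1_A (X t)).
  move=> mA mB; apply: EFin_inj; rewrite EFinM !Ex_level // muleC -H //.
  have [mX _] := bX; have [mY _] := bY.
  rewrite -Ex_indic.
    by congr (Ex P _)%:E; apply/funext => t; rewrite indicI mulrC.
  by apply: measurableI; rewrite -[_ @^-1` _]setTI; [apply: mX|apply: mY].
have HA A : measurable A ->
    Ex P (fun t => Y t * \1_A (X t)) = Ex P Y * Ex P (fun t => \1_A (X t)).
  move=> mA; have bA := bounded_rv_level bX mA.
  set p := Ex P (fun t => \1_A (X t)).
  have bp := bounded_rv_cst T p.
  suff : Ex P (fun t => Y t * (\1_A (X t) - p)) = 0.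
    under eq_fun do rewrite mulrBr.
    rewrite ExB; [|exact: bounded_rvM|exact: bounded_rvM].
    under [in X in _ - X]eq_fun do rewrite mulrC.
    by rewrite ExZ // mulrC => /eqP; rewrite subr_eq0 => /eqP.
  apply: Ex_orth_level_sets => //; first exact: bounded_rvB.
  move=> B mB; have bB := bounded_rv_level bY mB.
  under eq_fun do rewrite mulrBr.
  rewrite ExB; [|exact: bounded_rvM|exact: bounded_rvM].
  under [in X in _ - X]eq_fun do rewrite mulrC.
  by rewrite ExZ // HAB // -/p mulrC subrr.
set q := Ex P Y; have bq := bounded_rv_cst T q.
suff : Ex P (fun t => X t * (Y t - q)) = 0.
  under eq_fun do rewrite mulrBr.
  rewrite ExB; [|exact: bounded_rvM|exact: bounded_rvM].
  under [in X in _ - X]eq_fun do rewrite mulrC.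
  by rewrite ExZ // mulrC => /eqP; rewrite subr_eq0 => /eqP.
apply: Ex_orth_level_sets => //; first exact: bounded_rvB.
move=> A mA; have bA := bounded_rv_level bX mA.
under eq_fun do rewrite mulrBr.
rewrite ExB; [|exact: bounded_rvM|exact: bounded_rvM].
under [in X in _ - X]eq_fun do rewrite mulrC.
under eq_fun do rewrite mulrC.
by rewrite ExZ // HA // subrr.
Qed.

(** Induction on k for the hybrids [Z k], where the first k factors are the variables and the others
    are indicators of their level sets. The case k = 0 is the hypothesis. A step frees one index by
    [Ex_orth_level_sets], which needs the induction hypothesis for all families B. *)
Lemma Ex_indep (R : realType) (d : measure_display) (T : measurableType d)
    (P : probability T R) (n : nat) (X : 'I_n -> T -> R) :
  (forall j, bounded_rv (X j)) ->
  (forall B : 'I_n -> set R, (forall j, measurable (B j)) ->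
     P (\bigcap_(j in [set: 'I_n]) (X j @^-1` B j)) =
     (\prod_(j < n) P (X j @^-1` B j))%E) ->
  Ex P (fun t => \prod_(j < n) X j t) = \prod_(j < n) Ex P (X j).
Proof.
move=> bX H.
pose Z k (B : 'I_n -> set R) (j : 'I_n) t : R := if (j < k)%N then X j t else \1_(B j) (X j t).
have bZ k B j : (forall j, measurable (B j)) -> bounded_rv (Z k B j).
  by move=> mB; rewrite /Z; case: (j < k)%N => //; apply: bounded_rv_level.
suff HZ k B : (forall j, measurable (B j)) ->
    Ex P (fun t => \prod_(j < n) Z k B j t) = \prod_(j < n) Ex P (Z k B j).
  have := HZ n (fun=> setT) (fun=> measurableT).
  have E j : Z n (fun=> setT) j = X j by apply/funext => t; rewrite /Z ltn_ord.
  rewrite (eq_bigr (fun j => Ex P (X j))) => [<-|j _]; last by rewrite E.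
  by congr (Ex P _); apply/funext => t; apply: eq_bigr => j _; rewrite E.
elim: k B => [|k IH] B mB.
  rewrite /Z /=; apply: EFin_inj; rewrite -prodEFin.
  under [RHS]eq_bigr do rewrite Ex_level //.
  rewrite -H // -Ex_indic.
    congr (Ex P _)%:E; apply/funext => t.
    rewrite indicE; have [tB|tB] := boolP (t \in _).
      by rewrite big1 // => j _; move: tB; rewrite inE => /(_ j I) ?; rewrite indicE mem_set.
    have /existsNP[j /not_implyP[_ tj]] : ~ forall j, [set: 'I_n] j -> (X j @^-1` B j) t.
      by move=> h; move: tB; rewrite notin_setE; apply.
    by rewrite (bigD1 j) //= indicE memNset // mul0r.
  apply: fin_bigcap_measurable => // j _.
  by have [mX _] := bX j; rewrite -[_ @^-1` _]setTI; apply: mX.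
have [kn|kn] := ltnP k n; last first.
  have E (j : 'I_n) : Z k.+1 B j = Z k B j.
    by rewrite /Z ltnS (leq_trans (ltnW (ltn_ord j)) kn) (leq_trans (ltn_ord j) kn).
  have EP t : \prod_(j < n) Z k.+1 B j t = \prod_(j < n) Z k B j t.
    by apply: eq_bigr => j _; rewrite E.
  under eq_fun do rewrite EP.
  by under [RHS]eq_bigr do rewrite E; exact: IH.
pose j0 := Ordinal kn.
pose rest t := \prod_(j < n | j != j0) Z k.+1 B j t.
have brest : bounded_rv rest by apply: bounded_rv_prod => j; apply: bZ.
pose c := \prod_(j < n | j != j0) Ex P (Z k.+1 B j).
have Zj0 t : Z k.+1 B j0 t = X j0 t by rewrite /Z ltnSn.
suff : Ex P (fun t => X j0 t * (rest t - c)) = 0.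
  under eq_fun do rewrite mulrBr.
  rewrite ExB; [|exact: bounded_rvM|by apply: bounded_rvM => //; exact: bounded_rv_cst].
  under [in X in _ - X]eq_fun do rewrite mulrC.
  rewrite ExZ // => /eqP; rewrite subr_eq0 => /eqP e.
  rewrite [RHS](bigD1 j0) //= -/c mulrC.
  under eq_fun do rewrite (bigD1 j0) //= Zj0.
  by rewrite e; congr (_ * Ex P _); apply/funext => t; rewrite Zj0.
apply: Ex_orth_level_sets => //; first by apply: bounded_rvB => //; exact: bounded_rv_cst.
move=> C mC; have bC := bounded_rv_level (bX j0) mC.
under eq_fun do rewrite mulrBr.
rewrite ExB; [|exact: bounded_rvM|by apply: bounded_rvM => //; exact: bounded_rv_cst].
under [in X in _ - X]eq_fun do rewrite mulrC.
rewrite ExZ //.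
pose B' j := if j == j0 then C else B j.
have mB' j : measurable (B' j) by rewrite /B'; case: ifP.
have Z0 t : Z k B' j0 t = \1_C (X j0 t) by rewrite /Z ltnn /B' eqxx.
have Zne j : j != j0 -> Z k B' j = Z k.+1 B j.
  move=> jj0; have jk : (j : nat) <> k.
    by move=> e; move/eqP: jj0; apply; apply: val_inj.
  by rewrite /Z /B' (negPf jj0); have -> : (j < k.+1)%N = (j < k)%N by lia.
have EP t : \prod_(j < n) Z k B' j t = \1_C (X j0 t) * rest t.
  by rewrite (bigD1 j0) //= Z0; congr (_ * _); apply: eq_bigr => j /Zne ->.
have := IH B' mB'; under eq_fun do rewrite EP.
move=> ->; rewrite (bigD1 j0) //= (eq_bigr (fun j => Ex P (Z k.+1 B j))) => [|j /Zne -> //].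
by rewrite -/c [c * _]mulrC (_ : Z k B' j0 = fun t => \1_C (X j0 t)) ?subrr //; apply/funext.
Qed.

Lemma Ex_same_law (R : realType) (d d' de : measure_display) (T : measurableType d)
    (T' : measurableType d') (E : measurableType de)
    (P : probability T R) (P' : probability T' R) (X : T -> E) (X' : T' -> E) (F : E -> R) :
  measurable_fun [set: T] X -> measurable_fun [set: T'] X' ->
  (forall A, measurable A -> P (X @^-1` A) = P' (X' @^-1` A)) ->
  bounded_rv F -> Ex P (fun t => F (X t)) = Ex P' (fun t => F (X' t)).
Proof.
move=> mX mX' H bF; have [mF _] := bF.
have mEF : measurable_fun [set: E] (EFin \o F) by exact: measurableT_comp.
rewrite /Ex /Rintegral; congr fine.
have iX := bounded_rv_integrable P (bounded_rv_comp mX bF).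
have iX' := bounded_rv_integrable P' (bounded_rv_comp mX' bF).
have := @integral_pushforward _ _ _ _ R X mX P setT (EFin \o F) mEF.
rewrite preimage_setT => /(_ iX measurableT) <-.
have := @integral_pushforward _ _ _ _ R X' mX' P' setT (EFin \o F) mEF.
rewrite preimage_setT => /(_ iX' measurableT) <-.
by apply: eq_measure_integral => A mA _; apply: H.
Qed.

(** * Means of cosines of sums of independent variables *)

Lemma Re_mul_real (R : realType) (z : R[i]) (a : R) :
  complex.Re (z * a%:C%C) = complex.Re z * a.
Proof. by case: z => p q /=; rewrite mulr0 subr0. Qed.

(** The real part of the product of the exponentials, expanded; s marks the factors that contribute
    a sine, and the coefficient is the real part of the corresponding power of i. *)
Lemma cos_sum_expand (R : realType) (n : nat) (a : 'I_n -> R) :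
  cos (\sum_j a j) =
  \sum_(s : {ffun 'I_n -> bool})
    complex.Re (\prod_j (if s j then 'i%C else 1) : R[i]) *
    \prod_j (if s j then sin (a j) else cos (a j)).
Proof.
have -> : cos (\sum_j a j) = complex.Re (expi (\sum_j a j)) by [].
rewrite expi_sum.
have E j : expi (a j) = \sum_(b : bool) (if b then 'i%C else 1) *
    (if b then sin (a j) else cos (a j))%:C%C.
  rewrite big_bool /= /expi; apply/eqP; rewrite eq_complex /=.
  by apply/andP; split; apply/eqP; ring.
under eq_bigr do rewrite E.
rewrite bigA_distr_bigA /= (big_morph (@complex.Re R) (id1 := 0) (op1 := +%R)) //.
  by apply: eq_bigr => s _; rewrite big_split /= -rmorph_prod Re_mul_real.
by case=> ? ? [].
Qed.

Lemma bounded_rv_cos (R : realType) (d : measure_display) (T : measurableType d)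
    (f : T -> R) : measurable_fun [set: T] f -> bounded_rv (fun t => cos (f t)).
Proof.
move=> mf; split; last by exists 1 => t; apply: cos_max.
by apply: (measurableT_comp (f := @cos R)) mf;
  apply: continuous_measurable_fun; apply: continuous_cos.
Qed.

Lemma bounded_rv_sin (R : realType) (d : measure_display) (T : measurableType d)
    (f : T -> R) : measurable_fun [set: T] f -> bounded_rv (fun t => sin (f t)).
Proof.
move=> mf; split; last by exists 1 => t; apply: sin_max.
by apply: (measurableT_comp (f := @sin R)) mf;
  apply: continuous_measurable_fun; apply: continuous_sin.
Qed.

(** Multiplicativity of characteristic functions in real form: by independence every product
    containing a sine has mean zero, and only the product of all cosines survives. *)
Lemma Ex_cos_sum (R : realType) (d : measure_display) (T : measurableType d)
    (P : probability T R) (n : nat) (a : 'I_n -> T -> R) :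
  (forall j, measurable_fun [set: T] (a j)) ->
  (forall B : 'I_n -> set R, (forall j, measurable (B j)) ->
     P (\bigcap_(j in [set: 'I_n]) (a j @^-1` B j)) =
     (\prod_(j < n) P (a j @^-1` B j))%E) ->
  (forall j, Ex P (fun t => sin (a j t)) = 0) ->
  Ex P (fun t => cos (\sum_j a j t)) = \prod_j Ex P (fun t => cos (a j t)).
Proof.
move=> ma H s0.
pose F (s : {ffun 'I_n -> bool}) j x : R := if s j then sin x else cos x.
have mF s j : measurable_fun [set: R] (F s j).
  rewrite /F; case: (s j); apply: continuous_measurable_fun.
    exact: continuous_sin.
  exact: continuous_cos.
have bF s j : bounded_rv (fun t => F s j (a j t)).
  by rewrite /F; case: (s j); [exact: bounded_rv_sin|exact: bounded_rv_cos].
under eq_fun do rewrite cos_sum_expand.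
rewrite Ex_sum => [|s]; last first.
  by apply: bounded_rvZ; apply: bounded_rv_prod => j; apply: (bF s j).
have E s : Ex P (fun t => \prod_j F s j (a j t)) = \prod_j Ex P (fun t => F s j (a j t)).
  apply: (Ex_indep (X := fun j t => F s j (a j t))) => // B mB.
  have mB' j : measurable (F s j @^-1` B j) by rewrite -[_ @^-1` _]setTI; apply: mF.
  by rewrite -(H _ mB').
rewrite (bigD1 [ffun=> false]) //= [X in _ + X]big1 => [|s sn0].
  rewrite addr0 (_ : complex.Re _ = 1); last by rewrite big1 // => j _; rewrite ffunE.
  under eq_fun do rewrite mul1r.
  rewrite (E [ffun=> false]); apply: eq_bigr => j _.
  by rewrite /F ffunE.
rewrite ExZ; last by apply: bounded_rv_prod => j; apply: (bF s j).
rewrite (E s); have [j sj] : exists j, s j.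
  apply/existsP; apply: contraNT sn0 => /existsPn h.
  by apply/eqP/ffunP => j; rewrite ffunE; apply/negbTE/h.
rewrite [X in _ * X](bigD1 j) //= (_ : Ex P _ = 0) ?mul0r ?mulr0 //.
by rewrite -(s0 j); congr (Ex P _); apply/funext => t; rewrite /F sj.
Qed.

(** It lives on pairs of reals because laws and independence are stated through [reim]. *)
Definition linform (R : realType) (a b : R) (p : R * R) : R := a * p.1 + b * p.2.

Lemma measurable_linform (R : realType) (a b : R) :
  measurable_fun [set: R * R] (linform a b).
Proof.
by apply: measurable_funD; apply: measurable_funM.
Qed.

Lemma Ex_indep2_comp (R : realType) (d d1 d2 : measure_display) (T : measurableType d)
    (E1 : measurableType d1) (E2 : measurableType d2) (P : probability T R)
    (X : T -> E1) (Y : T -> E2) (F : E1 -> R) (G : E2 -> R) :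
  measurable_fun [set: T] X -> measurable_fun [set: T] Y ->
  independent2 P X Y -> bounded_rv F -> bounded_rv G ->
  Ex P (fun t => F (X t) * G (Y t)) = Ex P (fun t => F (X t)) * Ex P (fun t => G (Y t)).
Proof.
move=> mX mY H bF bG; apply: Ex_indep2; [exact: bounded_rv_comp|exact: bounded_rv_comp|].
move=> A B mA mB; have [mF _] := bF; have [mG _] := bG.
by apply: (H (F @^-1` A) (G @^-1` B)); rewrite -[_ @^-1` _]setTI; [apply: mF|apply: mG].
Qed.

Lemma Ex_lazy (R : realType) (d : measure_display) (T : measurableType d)
    (P : probability T R) (mu : R) (x1 x2 : T -> R[i]) (I : T -> bool)
    (F : (R * R) * (R * R) -> R) :
  complexRV x1 -> complexRV x2 -> measurable_fun [set: T] I ->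
  P (I @^-1` [set true]) = (mu / 2)%:E ->
  independent2 P (fun t => (reim (x1 t), reim (x2 t))) I -> bounded_rv F ->
  Ex P (fun t => F (reim (x1 t), reim (x2 t)) * (I t)%:R) =
  Ex P (fun t => F (reim (x1 t), reim (x2 t))) * (mu / 2).
Proof.
move=> m1 m2 mI PI H bF.
have bG : bounded_rv (fun b : bool => b%:R : R).
  by split=> //; exists 1 => -[]; rewrite ?normr1 ?normr0.
have -> : mu / 2 = Ex P (fun t => (I t)%:R).
  apply: EFin_inj; rewrite -PI -Ex_indic.
    congr (Ex P _)%:E; apply/funext => t; rewrite indicE.
    by case E : (I t); [rewrite mem_set|rewrite memNset //= E].
  by rewrite -[_ @^-1` _]setTI; apply: mI.
apply: (Ex_indep2_comp (G := fun b : bool => b%:R)) => //.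
exact: measurable_fun_pair.
Qed.

(** * Lazy differences *)

Lemma linformB (R : realType) (a b : R) (z w : R[i]) :
  linform a b (reim (z - w)) = linform a b (reim z) - linform a b (reim w).
Proof. by case: z w => ? ? [? ?]; rewrite /linform /=; ring. Qed.

(** Where I vanishes the phase is 0, so the cosine equals 1 - (1 - cos) I and the sine equals sin
    times I. The sine of the difference has mean zero because the addition formula is antisymmetric
    in two independent copies with the same law. *)
Lemma lazy_char (R : realType) (d d' : measure_display) (T : measurableType d)
    (T' : measurableType d') (P : probability T R) (x : T -> R[i]) (mu : R)
    (P' : probability T' R) (x1 x2 : T' -> R[i]) (I : T' -> bool) (a b : R) :
  complexRV x -> complexRV x1 -> complexRV x2 -> measurable_fun [set: T'] I ->
  same_law P x P' x1 -> same_law P x P' x2 ->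
  independent2 P' (@reim R \o x1) (@reim R \o x2) ->
  P' (I @^-1` [set true]) = (mu / 2)%:E ->
  independent2 P' (fun t => (reim (x1 t), reim (x2 t))) I ->
  Ex P' (fun t => cos (linform a b (reim ((x1 t - x2 t) * (I t)%:R)))) =
    1 - mu / 2 * Ex P' (fun t => 1 - cos (linform a b (reim (x1 t - x2 t)))) /\
  Ex P' (fun t => sin (linform a b (reim ((x1 t - x2 t) * (I t)%:R)))) = 0.
Proof.
move=> mx m1 m2 mI l1 l2 i12 PI iI.
have ml := measurable_linform a b.
pose D (p : (R * R) * (R * R)) := linform a b p.1 - linform a b p.2.
have mD : measurable_fun setT D.
  by apply: measurable_funB; apply: measurableT_comp ml _.
have bc : bounded_rv (fun p => 1 - cos (D p)).
  by apply: bounded_rvB; [exact: bounded_rv_cst|exact: bounded_rv_cos].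
have m12 : measurable_fun setT (fun t => (reim (x1 t), reim (x2 t))) by exact: measurable_fun_pair.
have DE t : linform a b (reim (x1 t - x2 t)) = D (reim (x1 t), reim (x2 t)) by rewrite linformB.
have l0 : linform a b (reim 0) = 0 by rewrite /linform /= !mulr0 addr0.
split.
  have E t : cos (linform a b (reim ((x1 t - x2 t) * (I t)%:R))) =
      1 - (1 - cos (D (reim (x1 t), reim (x2 t)))) * (I t)%:R.
    by case: (I t); rewrite ?mulr1 ?mulr0 -?DE ?l0 ?cos0; ring.
  under eq_fun do rewrite E.
  have bi : bounded_rv (fun t => (I t)%:R : R).
    apply: (@bounded_rv_comp _ _ _ _ _ _ (fun b : bool => b%:R)) => //; split=> //.
    by exists 1 => -[]; rewrite ?normr1 ?normr0.
  rewrite ExB; [|exact: bounded_rv_cst|apply: bounded_rvM => //; exact: bounded_rv_comp m12 bc].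
  rewrite Ex_cst (Ex_lazy (F := fun p => 1 - cos (D p)) m1 m2 mI PI iI bc) mulrC.
  by under [in RHS]eq_fun do rewrite DE.
have bs : bounded_rv (fun p => sin (D p)) by exact: bounded_rv_sin.
have E t : sin (linform a b (reim ((x1 t - x2 t) * (I t)%:R))) =
    sin (D (reim (x1 t), reim (x2 t))) * (I t)%:R.
  by case: (I t); rewrite ?mulr1 ?mulr0 -?DE ?l0 ?sin0.
under eq_fun do rewrite E.
rewrite (Ex_lazy (F := fun p => sin (D p)) m1 m2 mI PI iI bs).
suff -> : Ex P' (fun t => sin (D (reim (x1 t), reim (x2 t)))) = 0 by rewrite mul0r.
pose S p := sin (linform a b p); pose C p := cos (linform a b p).
have bS : bounded_rv S by exact: bounded_rv_sin.
have bC : bounded_rv C by exact: bounded_rv_cos.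
have E2 t : sin (D (reim (x1 t), reim (x2 t))) =
    S (reim (x1 t)) * C (reim (x2 t)) - C (reim (x1 t)) * S (reim (x2 t)).
  by rewrite /D sinB.
under eq_fun do rewrite E2.
have bS1 := bounded_rv_comp m1 bS; have bS2 := bounded_rv_comp m2 bS.
have bC1 := bounded_rv_comp m1 bC; have bC2 := bounded_rv_comp m2 bC.
rewrite ExB; [|exact: bounded_rvM|exact: bounded_rvM].
rewrite (Ex_indep2_comp m1 m2 i12 bS bC) (Ex_indep2_comp m1 m2 i12 bC bS).
rewrite -(Ex_same_law mx m1 l1 bS) -(Ex_same_law mx m2 l2 bS).
by rewrite -(Ex_same_law mx m1 l1 bC) -(Ex_same_law mx m2 l2 bC) mulrC subrr.
Qed.

(** * Truncated moments and the separation of two copies *)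

Definition in_disk (R : realType) (k : R) (p : R * R) : R :=
  \1_[set p | p.1 ^+ 2 + p.2 ^+ 2 <= k ^+ 2] p.

Lemma in_diskE (R : realType) (k : R) (z : R[i]) : 0 <= k ->
  in_disk k (reim z) = (cabs z <= k)%R%:R.
Proof.
move=> k0; rewrite /in_disk indicE; congr ((nat_of_bool _)%:R).
have -> : (cabs z <= k) = (complex.Re z ^+ 2 + complex.Im z ^+ 2 <= k ^+ 2).
  by rewrite -(@ler_pXn2r _ 2) ?nnegrE ?cabs_ge0 // cabs_sqr.
by apply/idP/idP => h; [rewrite inE in h|rewrite inE].
Qed.

Lemma measurable_in_disk (R : realType) (k : R) :
  measurable [set p : R * R | p.1 ^+ 2 + p.2 ^+ 2 <= k ^+ 2].
Proof.
have m : measurable_fun [set: R * R] (fun p : R * R => p.1 ^+ 2 + p.2 ^+ 2).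
  by apply: measurable_funD; apply: measurable_funX.
have := m measurableT [set` `]-oo, k ^+ 2]%R] (measurable_itv _).
rewrite setTI; congr (measurable _); apply/seteqP; split=> p /=; rewrite in_itv //=.
Qed.

Lemma bounded_rv_disk_moment (R : realType) (k w : R) (n : nat) : 0 <= k ->
  bounded_rv (fun p : R * R => (p.1 - w) ^+ n * in_disk k p).
Proof.
move=> k0; split.
  apply: measurable_funM; last exact: measurable_indic (measurable_in_disk k).
  by apply: measurable_funX; apply: measurable_funB.
exists ((k + `|w|) ^+ n) => p; rewrite /in_disk indicE.
case: (boolP (p \in _)) => [|_]; last first.
  by rewrite mulr0 normr0 exprn_ge0 // addr_ge0.
rewrite inE /= => pk; rewrite mulr1 normrX lerXn2r ?nnegrE ?addr_ge0 //.
apply: le_trans (ler_normB _ _) _; rewrite lerD2r.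
rewrite -(@ler_pXn2r _ 2) ?nnegrE // real_normK ?num_real //.
by have := sqr_ge0 p.2; lra.
Qed.

Lemma cabsB_le (R : realType) (z w : R[i]) : cabs (z - w) <= cabs z + cabs w.
Proof. by apply: le_trans (le_normcD z (- w)) _; rewrite normcN. Qed.

Definition disk_moment (R : realType) (d : measure_display) (T : measurableType d)
    (P : probability T R) (kappa : R) (x : T -> R[i]) (n : nat) : R :=
  Ex P (fun t => complex.Re (x t) ^+ n * in_disk kappa (reim (x t))).

(** Write s_n for the truncated moments. Taking z = 1 and w real gives 1/kappa <= s_2 - 2 w s_1 +
    w^2 s_0. The minimizer w = s_1/s_0 yields s_0/kappa as a lower bound; w = 0 together with s_2 <=
    kappa^2 s_0 yields s_0 >= kappa^-3. *)
Lemma controlled_variance (R : realType) (d : measure_display) (T : measurableType d)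
    (P : probability T R) (kappa : R) (x : T -> R[i]) : 1 <= kappa ->
  complexRV x -> controlled_second_moment P kappa x ->
  kappa^-1 ^+ 4 <=
    disk_moment P kappa x 2 * disk_moment P kappa x 0 - disk_moment P kappa x 1 ^+ 2.
Proof.
move=> k1 mx [_ H]; pose s := disk_moment P kappa x; rewrite -!/(s _); have k0 : 0 <= kappa by lra.
have kp : 0 < kappa by lra.
have bm n w : bounded_rv (fun t => (complex.Re (x t) - w) ^+ n * in_disk kappa (reim (x t))).
  exact: bounded_rv_comp mx (bounded_rv_disk_moment w n k0).
have bs n : bounded_rv (fun t => complex.Re (x t) ^+ n * in_disk kappa (reim (x t))).
  by have := bm n 0; under eq_fun do rewrite subr0.
have Hw w : kappa^-1 <= s 2%N - 2 * w * s 1%N + w ^+ 2 * s 0%N.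
  have := H 1 (w%:C)%C.
  have E t : complex.Re (1 * x t - (w%:C)%C) ^+ 2 * \1_[set u | cabs (x u) <= kappa] t =
      (complex.Re (x t) - w) ^+ 2 * in_disk kappa (reim (x t)).
    rewrite mul1r in_diskE // indicE; congr (_ ^+ 2 * (nat_of_bool _)%:R).
      by case: (x t).
    by apply/idP/idP => h; [rewrite inE in h|rewrite inE].
  under eq_fun do rewrite E.
  rewrite expectation_Ex // lee_fin /= expr1n mulr1 => /le_trans; apply.
  rewrite le_eqVlt; apply/orP; left; apply/eqP.
  have E2 t : (complex.Re (x t) - w) ^+ 2 * in_disk kappa (reim (x t)) =
      complex.Re (x t) ^+ 2 * in_disk kappa (reim (x t)) -
      2 * w * (complex.Re (x t) ^+ 1 * in_disk kappa (reim (x t))) +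
      w ^+ 2 * (complex.Re (x t) ^+ 0 * in_disk kappa (reim (x t))) by ring.
  under eq_fun do rewrite E2.
  have bz c n := bounded_rvZ c (bs n).
  rewrite ExD; [|exact: bounded_rvB (bs 2%N) (bz _ _)|exact: bz].
  rewrite ExB; [|exact: bs|exact: bz].
  by rewrite (ExZ P (2 * w) (bs 1%N)) (ExZ P (w ^+ 2) (bs 0%N)).
have ki : 0 < kappa^-1 by rewrite invr_gt0.
have ki1 : kappa^-1 * kappa = 1 by rewrite mulVf // gt_eqF.
have s20 : s 2%N <= kappa ^+ 2 * s 0%N.
  rewrite -(ExZ P (kappa ^+ 2) (bs 0%N)).
  apply: Ex_le; [exact: bs|exact: bounded_rvZ (bs 0%N)|].
  move=> t; rewrite in_diskE // expr0 mul1r.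
  case: (boolP (cabs _ <= _)) => h; last by rewrite !mulr0.
  rewrite !mulr1; apply: (@le_trans _ _ (cabs (x t) ^+ 2)); last first.
    by rewrite lerXn2r ?nnegrE ?cabs_ge0.
  by rewrite cabs_sqr lerDl sqr_ge0.
have s0k : kappa^-1 ^+ 3 <= s 0%N.
  have := Hw 0; rewrite mulr0 mul0r subr0 expr0n mul0r addr0 => h.
  have := le_trans h s20 => h2.
  have -> : s 0%N = kappa^-1 ^+ 2 * (kappa ^+ 2 * s 0%N) by rewrite mulrA -exprMn ki1 expr1n mul1r.
  by rewrite exprSr ler_wpM2l // exprn_ge0 // ltW.
have s00 : 0 < s 0%N by apply: lt_le_trans s0k; rewrite exprn_gt0.
have := Hw (s 1%N / s 0%N).
have -> : s 2%N - 2 * (s 1%N / s 0%N) * s 1%N + (s 1%N / s 0%N) ^+ 2 * s 0%N =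
    (s 2%N * s 0%N - s 1%N ^+ 2) / s 0%N.
  by field; rewrite gt_eqF.
rewrite ler_pdivlMr // => h; apply: le_trans h.
by rewrite exprS ler_wpM2l // ltW.
Qed.

(** Let D be the difference of the real parts. On the event that both copies lie in the disk, D^2
    has truncated mean 2 (s_2 s_0 - s_1^2) >= 2 kappa^-4. Points with D^2 < kappa^-4 contribute at
    most kappa^-4, the others at most 4 kappa^2 times their probability, which is therefore at least
    kappa^-6 / 4. *)
Lemma separated_event (R : realType) (d d' : measure_display) (T : measurableType d)
    (T' : measurableType d') (P : probability T R) (P' : probability T' R)
    (kappa : R) (x : T -> R[i]) (x1 x2 : T' -> R[i]) : 1 <= kappa ->
  complexRV x -> controlled_second_moment P kappa x ->
  complexRV x1 -> complexRV x2 -> same_law P x P' x1 -> same_law P x P' x2 ->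
  independent2 P' (@reim R \o x1) (@reim R \o x2) ->
  exists A : set T', [/\ measurable A, kappa^-1 ^+ 6 / 4 <= Ex P' \1_A &
    forall t, A t -> kappa^-1 ^+ 2 <= cabs (x1 t - x2 t) <= 2 * kappa].
Proof.
move=> k1 mx Hx m1 m2 l1 l2 i12; have k0 : 0 <= kappa by lra.
have kp : 0 < kappa by lra.
have ki : 0 < kappa^-1 by rewrite invr_gt0.
have ki1 : kappa^-1 * kappa = 1 by rewrite mulVf // gt_eqF.
pose h n (p : R * R) := p.1 ^+ n * in_disk kappa p.
have bh n : bounded_rv (h n).
  by have := bounded_rv_disk_moment 0 n k0; under eq_fun do rewrite subr0.
pose s n := Ex P (fun t => h n (reim (x t))).
have Hs : kappa^-1 ^+ 4 <= s 2%N * s 0%N - s 1%N ^+ 2 := controlled_variance k1 mx Hx.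
pose B1 := [set t | cabs (x1 t) <= kappa]; pose B2 := [set t | cabs (x2 t) <= kappa].
have mB (z : T' -> R[i]) : complexRV z -> measurable [set t | cabs (z t) <= kappa].
  move=> mz; have := mz measurableT _ (measurable_in_disk kappa); rewrite setTI.
  congr (measurable _); apply/seteqP; split=> t /=;
    by rewrite -[cabs _ <= _](@ler_pXn2r _ 2) ?nnegrE ?cabs_ge0 // cabs_sqr.
pose D t := complex.Re (x1 t) - complex.Re (x2 t).
have mRe (z : T' -> R[i]) : complexRV z -> measurable_fun setT (fun t => complex.Re (z t)).
  by move=> mz; apply: (measurableT_comp measurable_fst mz).
have mD : measurable_fun setT D by apply: measurable_funB; apply: mRe.
pose S := [set t | kappa^-1 ^+ 4 <= D t ^+ 2].
have mS : measurable S.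
  have mD2 : measurable_fun setT (fun t => D t ^+ 2) by exact: measurable_funX.
  have := mD2 measurableT [set` `[kappa^-1 ^+ 4, +oo[%R] (measurable_itv _).
  rewrite setTI; congr (measurable _); apply/seteqP; split=> t /=; by rewrite in_itv /= andbT.
have mA : measurable (B1 `&` B2 `&` S) by do 2?apply: measurableI => //; apply: mB.
exists (B1 `&` B2 `&` S); split=> //; last first.
  move=> t [[b1 b2] sD]; apply/andP; split; last first.
    have h1 : cabs (x1 t) <= kappa := b1; have h2 : cabs (x2 t) <= kappa := b2.
    by apply: le_trans (cabsB_le _ _) _; lra.
  rewrite -(@ler_pXn2r _ 2) ?nnegrE ?cabs_ge0 ?exprn_ge0 ?(ltW ki) // -exprM.
  apply: le_trans sD _; rewrite cabs_sqr /coord.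
  have -> : complex.Re (x1 t - x2 t) = D t by rewrite /D; case: (x1 t) (x2 t) => ? ? [].
  by rewrite lerDl sqr_ge0.
pose V t := D t ^+ 2 * (in_disk kappa (reim (x1 t)) * in_disk kappa (reim (x2 t))).
have b1 n := bounded_rv_comp m1 (bh n); have b2 n := bounded_rv_comp m2 (bh n).
have VE t : V t = h 2%N (reim (x1 t)) * h 0%N (reim (x2 t))
    - 2 * (h 1%N (reim (x1 t)) * h 1%N (reim (x2 t)))
    + h 0%N (reim (x1 t)) * h 2%N (reim (x2 t)) by rewrite /V /D /h /=; ring.
have E1 n : Ex P' (fun t => h n (reim (x1 t))) = s n by rewrite -(Ex_same_law mx m1 l1).
have E2 n : Ex P' (fun t => h n (reim (x2 t))) = s n by rewrite -(Ex_same_law mx m2 l2).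
have bhh n m : bounded_rv (fun t => h n (reim (x1 t)) * h m (reim (x2 t))).
  exact: bounded_rvM (b1 n) (b2 m).
have b11 := bounded_rvZ 2 (bhh 1%N 1%N).
have bV : bounded_rv V.
  by rewrite (funext VE); exact: bounded_rvD (bounded_rvB (bhh 2%N 0%N) b11) (bhh 0%N 2%N).
have EV : Ex P' V = 2 * (s 2%N * s 0%N - s 1%N ^+ 2).
  rewrite (funext VE) (ExD P' (bounded_rvB (bhh 2%N 0%N) b11) (bhh 0%N 2%N)).
  rewrite (ExB P' (bhh 2%N 0%N) b11) (ExZ P' 2 (bhh 1%N 1%N)).
  have E n m : Ex P' (fun t => h n (reim (x1 t)) * h m (reim (x2 t))) = s n * s m.
    by rewrite (Ex_indep2_comp m1 m2 i12 (bh n) (bh m)) E1 E2.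
  by rewrite !E; ring.
have bI := bounded_rv_indic R mA.
have VA : Ex P' V <= kappa^-1 ^+ 4 + 4 * kappa ^+ 2 * Ex P' \1_(B1 `&` B2 `&` S).
  rewrite -{1}(Ex_cst P' (kappa^-1 ^+ 4)) -ExZ // -ExD; [|exact: bounded_rv_cst|exact: bounded_rvZ].
  apply: Ex_le => //; first by apply: bounded_rvD; [exact: bounded_rv_cst|exact: bounded_rvZ].
  move=> t; have k40 : 0 <= kappa^-1 ^+ 4 by rewrite exprn_ge0 // ltW.
  have k20 : 0 <= 4 * kappa ^+ 2 by rewrite mulr_ge0 // sqr_ge0.
  have R0 : 0 <= kappa^-1 ^+ 4 + 4 * kappa ^+ 2 * \1_(B1 `&` B2 `&` S) t.
    by rewrite addr_ge0 // mulr_ge0 // indicE.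
  rewrite /V !in_diskE //.
  case: (boolP (cabs (x1 t) <= _)) => h1; last by rewrite mul0r mulr0.
  case: (boolP (cabs (x2 t) <= _)) => h2; last by rewrite !mulr0.
  rewrite !mulr1; have [sD|/ltW sD] := leP (kappa^-1 ^+ 4) (D t ^+ 2); last first.
    by apply: le_trans sD _; rewrite lerDl mulr_ge0 // indicE.
  rewrite indicE mem_set // mulr1; apply: ler_wpDl => //.
  have -> : 4 * kappa ^+ 2 = (2 * kappa) ^+ 2 by rewrite exprMn -natrX.
  rewrite -(real_normK (num_real (D t))) lerXn2r ?nnegrE ?mulr_ge0 //.
  have := coord_le_cabs false (x1 t); have := coord_le_cabs false (x2 t).
  have := ler_normB (complex.Re (x1 t)) (complex.Re (x2 t)).
  by rewrite /coord -/(D t); lra.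
rewrite {}EV in VA; set p := Ex P' _ in VA *.
have hp : kappa^-1 ^+ 4 <= 4 * kappa ^+ 2 * p by lra.
have -> : p = kappa^-1 ^+ 2 * (4 * kappa ^+ 2 * p) / 4.
  have -> : kappa^-1 ^+ 2 * (4 * kappa ^+ 2 * p) / 4 = (kappa^-1 * kappa) ^+ 2 * p.
    by field; rewrite gt_eqF.
  by rewrite ki1 expr1n mul1r.
by rewrite ler_pM2r ?invr_gt0 // (exprD _ 2 4) ler_wpM2l // exprn_ge0 // ltW.
Qed.

(* Jensen's inequality for exp, conditionally on A. *)
Lemma sum_exp_Ex_le (R : realType) (d : measure_display) (T : measurableType d)
    (P : probability T R) (A : set T) (p0 S : R) (I : finType) (c : I -> R)
    (Z : I -> T -> R) :
  measurable A -> 0 < p0 <= Ex P \1_A -> (forall k, 0 <= c k) ->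
  (forall k, bounded_rv (Z k)) -> (forall k t, 0 <= Z k t) ->
  (forall t, A t -> \sum_k c k * expR (- (p0 * Z k t)) <= S) ->
  \sum_k c k * expR (- Ex P (Z k)) <= S.
Proof.
move=> mA /andP[p00 p0p] c0 bZ Z0 HS.
have bA := bounded_rv_indic R mA; set p := Ex P \1_A in p0p *.
have pp : 0 < p by apply: lt_le_trans p0p.
have A01 t : (\1_A t = 0 :> R) \/ (\1_A t = 1 :> R).
  by rewrite indicE; case: (t \in A); [right|left].
have A0 t : (0 : R) <= \1_A t by case: (A01 t) => ->.
have bexp k : bounded_rv (fun t => expR (- (p0 * Z k t))).
  split; last first.
    exists 1 => t; rewrite ger0_norm ?expR_ge0 // -expR0 ler_expR oppr_le0.
    by rewrite mulr_ge0 // ltW.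
  have [mZ _] := bounded_rvZ p0 (bZ k).
  by apply: (measurableT_comp (@measurable_expR R)); apply: measurableT_comp.
have bAe k := bounded_rvM bA (bexp k).
have key k : p * expR (- Ex P (Z k)) <= Ex P (fun t => \1_A t * expR (- (p0 * Z k t))).
  pose e0 := Ex P (fun t => \1_A t * Z k t).
  have bAZ : bounded_rv (fun t => \1_A t * Z k t) by exact: bounded_rvM.
  have e0Z : e0 <= Ex P (Z k).
    apply: Ex_le => // t; case: (A01 t) => ->; rewrite ?mul0r ?mul1r //.
  apply: (@le_trans _ _ (p * expR (- e0))).
    by rewrite ler_pM2l // ler_expR lerN2.
  (* Convexity enters through the tangent line of exp at -e0; restricted to A its mean is exactly p
     exp(-e0), since [e0] is the mean of Z on A. *)
  have bL : bounded_rv (fun t => expR (- e0) * ((1 + e0) * \1_A t - p * (\1_A t * Z k t))).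
    by apply/bounded_rvZ/bounded_rvB; exact: bounded_rvZ.
  apply: (@le_trans _ _ (Ex P (fun t => expR (- e0) * ((1 + e0) * \1_A t - p * (\1_A t * Z k t))))).
    rewrite ExZ; last by apply: bounded_rvB; exact: bounded_rvZ.
    rewrite ExB; [|exact: bounded_rvZ|exact: bounded_rvZ].
    by rewrite !ExZ // -/p -/e0; lra.
  apply: Ex_le => // t; case: (A01 t) => ->; first by rewrite !mul0r !mulr0 subr0 mulr0.
  rewrite mulr1 !mul1r; apply: (@le_trans _ _ (expR (- (p * Z k t)))); last first.
    by rewrite ler_expR lerN2 ler_wpM2r.
  have -> : - (p * Z k t) = - e0 + (e0 - p * Z k t) by ring.
  rewrite expRD ler_wpM2l ?expR_ge0 //; apply: le_trans (expR_ge1Dx _); lra.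
rewrite -(ler_pM2l pp) mulr_sumr.
have bAS : bounded_rv (fun t => S * \1_A t) by exact: bounded_rvZ.
have bs k : bounded_rv (fun t => c k * (\1_A t * expR (- (p0 * Z k t)))) by exact: bounded_rvZ.
apply: (@le_trans _ _ (Ex P (fun t => \sum_k c k * (\1_A t * expR (- (p0 * Z k t)))))).
  rewrite Ex_sum //; apply: ler_sum => k _.
  by rewrite ExZ // mulrCA ler_wpM2l.
rewrite -[p * S]mulrC -(ExZ P S bA); apply: Ex_le => //; first exact: bounded_rv_sum.
move=> t; under eq_bigr do rewrite mulrCA.
rewrite -mulr_sumr mulrC; have [tA|tA] := boolP (t \in A).
  by rewrite indicE tA !mulr1; apply: HS; rewrite inE in tA.
by rewrite indicE (negPf tA) !mulr0.
Qed.

(** * From the Gaussian mean to the dispersion *)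

(** Apply exp(-s) <= 1/(1+s). With K the integer part of M the kernel is 1/(1 + 2 K (K+1) (1 - cos
    t)), and K (K+1) <= 2 M^2, including M < 1, where K = 0. *)
Lemma exp_le_pkernel (R : realType) (M p0 t : R) : 0 <= M -> 0 < p0 <= 1 ->
  expR (- (p0 * (M ^+ 2 / 2 * (1 - cos t)))) <=
  8 / p0 * pkernel (Num.truncn M).+1 t.
Proof.
move=> M0 /andP[p00 p01]; have ct := cos_le1 t.
set K : R := (Num.truncn M)%:R.
have K0 : 0 <= K by rewrite ler0n.
have KM : K <= M by rewrite truncn_le.
have KK : K * (K + 1) <= 2 * M ^+ 2.
  have [h|h] := leP 1 K; first by nra.
  have -> : K = 0; last by rewrite mul0r mulr_ge0 // sqr_ge0.
  by move: h; rewrite /K ltrn1 ltnS leqn0 => /eqP ->.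
set s := 1 - cos t; have s0 : 0 <= s by rewrite subr_ge0.
rewrite /pkernel (_ : (Num.truncn M).+1%:R = K + 1); last by rewrite natr1.
rewrite addrK -/s.
have KKs : K * (K + 1) * s <= 2 * M ^+ 2 * s by exact: ler_wpM2r.
have KK0 : 0 <= K * (K + 1) * s by rewrite !mulr_ge0 // addr_ge0.
have Ms0 : 0 <= M ^+ 2 * s by rewrite mulr_ge0 // sqr_ge0.
have den : 0 < 1 + 2 * (K + 1) * K * s by rewrite ltr_wpDr //; lra.
have den2 : 0 < 1 + p0 * (M ^+ 2 / 2 * s) by rewrite ltr_wpDr // mulr_ge0 ?(ltW p00) //; lra.
rewrite expRN; apply: (@le_trans _ _ (1 + p0 * (M ^+ 2 / 2 * s))^-1).
  by rewrite lef_pV2 ?posrE ?expR_gt0 // expR_ge1Dx.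
have h1 : p0 * (1 + 2 * (K + 1) * K * s) <= p0 * (1 + 4 * M ^+ 2 * s).
  by apply: ler_wpM2l; [exact: ltW|lra].
have -> : 8 / p0 * (1 + 2 * (K + 1) * K * s)^-1 = (p0 * (1 + 2 * (K + 1) * K * s) / 8)^-1.
  by field; rewrite !gt_eqF.
rewrite lef_pV2 ?posrE //; last by rewrite divr_gt0 // mulr_gt0.
lra.
Qed.

Lemma plane_form_sum (R : realType) (Lam : R) (N n : nat) (k : {ffun bool -> bool * 'I_N})
    (z : 'I_n -> R[i]) :
  plane_form Lam k (\sum_j z j) = \sum_j plane_form Lam k (z j).
Proof.
rewrite (big_morph (plane_form Lam k) (id1 := 0) (op1 := +%R)) //.
  by move=> a b; rewrite -big_split; apply: eq_bigr => e _; rewrite coordD mulrDl mulrDr.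
by rewrite /plane_form big1 // => -[] _; rewrite mul0r mulr0.
Qed.

Lemma coord_mul (R : realType) (e : bool) (w z : R[i]) :
  coord e (w * z) = linform (coord e w) (coord e (w * 'i%C)) (reim z).
Proof. by case: e w z => -[a b] [p q]; rewrite /linform /=; ring. Qed.

Lemma coord_sum (R : realType) (e : bool) (n : nat) (z : 'I_n -> R[i]) :
  coord e (\sum_j z j) = \sum_j coord e (z j).
Proof. by apply: (big_morph _ (@coordD R e)); case: e. Qed.

Lemma plane_form_linform (R : realType) (Lam : R) (N : nat) (k : {ffun bool -> bool * 'I_N})
    (w z : R[i]) :
  plane_form Lam k (w * z) =
  linform (plane_form Lam k w) (plane_form Lam k (w * 'i%C)) (reim z).
Proof.
rewrite /linform /plane_form !mulr_suml -big_split /=; apply: eq_bigr => e _.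
by rewrite coord_mul /linform /=; ring.
Qed.

Lemma big_repeated_tuple (R : realType) (r : nat) (v : 'I_r -> R[i]) (L : 'I_r -> R)
    (phi : R[i] -> R) :
  \prod_(j < size (repeated_tuple v L)) phi (repeated_tuple v L)`_j =
  \prod_(i < r) phi (v i) ^+ Num.truncn (L i ^+ 2).
Proof.
rewrite -(big_mkord xpredT (fun j => phi (repeated_tuple v L)`_j)).
rewrite -(big_nth 0 xpredT phi) /repeated_tuple big_flatten big_map big_enum /=.
by apply: eq_bigr => i _; rewrite big_nseq iter_mulr_1.
Qed.

(** As pi >= 1, the Gaussian is at most the product of exp(-u^2) over the two coordinates u of W;
    each factor is replaced by its majorant and the product is expanded. *)
Lemma gauss_le_plane_sum (R : realType) (Lam : R) (N : nat) (d : nat -> R) (W : R[i]) :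
  (forall u, expR (- u ^+ 2) <= 2 * \sum_(j < N) d j * cos (j%:R * (u / Lam))) ->
  expR (- (pi * cabs W ^+ 2)) <=
  \sum_(k : {ffun bool -> bool * 'I_N}) (\prod_e d (k e).2) * cos (plane_form Lam k W).
Proof.
move=> H; rewrite -(prod_cos_expand N (fun=> d) (fun e => coord e W / Lam)).
apply: (@le_trans _ _ (\prod_e expR (- coord e W ^+ 2))).
  rewrite big_bool /= -expRD ler_expR cabs_sqr.
  have := pi_ge2 R; have := sqr_ge0 (coord true W); have := sqr_ge0 (coord false W).
  by move: (coord _ _ ^+ 2) (coord _ _ ^+ 2) => u w *; nra.
by apply: ler_prod => e _; rewrite expR_ge0 H.
Qed.

(** The bound with exponent -1. The first factor of the constant comes from [exp_le_pkernel] with p0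
    = kappa^-6 / 4, the probability in [separated_event]; the second is [poisson_sum_dispersion] for
    kappa^-2 <= |y| <= 2 kappa. *)
Lemma gaussian_mean_le_dispersion (R : realType) (kappa : R) (r : nat) (hkappa : 1 <= kappa)
  (d : measure_display) (T : measurableType d) (P : probability T R)
  (x : T -> R[i]) (mu : R) (v : 'I_r -> R[i]) (L : 'I_r -> R) :
  complexRV x -> controlled_second_moment P kappa x -> 0 < mu <= 1 ->
  (forall i, 0 < L i) -> (forall i, L i ^+ 2 \is a Num.int) ->
  forall (d1 : measure_display) (T1 : measurableType d1)
    (P1 : probability T1 R) (xmu : T1 -> R[i]),
  lazy_difference P x mu P1 xmu ->
  forall (d2 : measure_display) (T2 : measurableType d2) (P2 : probability T2 R)
    (y : 'I_(size (repeated_tuple v L)) -> T2 -> R[i]),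
  iid_copies P1 xmu P2 y ->
  (gaussian_mean P2 y <=
    ((8 / (kappa^-1 ^+ 6 / 4)) ^+ r *
     (48 ^+ r * (4 * (1 + 2 / ((kappa^-1 ^+ 2) ^+ 2 / 16))) ^+ 2 /
      dispersion (symGAP v (fun i => Num.sqrt mu * L i))))%:E)%E.
Proof.
move=> mx Hx /andP[mu0 mu1] L0 Lint d1 T1 P1 xmu.
case=> x1 [x2 [I [[m1 m2 mI] [l1 l2 i12] PI iI xmuE]]] d2 T2 P2 y [my lawy indy].
have [A [mA pA Asep]] := separated_event hkappa mx Hx m1 m2 l1 l2 i12.
pose p0 := kappa^-1 ^+ 6 / 4; rewrite -/p0.
have kp : 0 < kappa by lra.
have ki : 0 < kappa^-1 by rewrite invr_gt0.
have p00 : 0 < p0 by rewrite divr_gt0 // exprn_gt0.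
have p01 : p0 <= 1.
  have : kappa^-1 ^+ 6 <= 1 by rewrite exprn_ile1 ?(ltW ki) // invf_le1.
  by rewrite /p0; lra.
pose M i := Num.sqrt mu * L i.
have M0 i : 0 <= M i by rewrite mulr_ge0 ?sqrtr_ge0 // ltW.
have c0 : 0 < kappa^-1 ^+ 2 by rewrite exprn_gt0.
have [Lam [N [dd [dd0 Hdd HS]]]] := @poisson_sum_dispersion R r v M _ (2 * kappa) M0 c0.
set w := repeated_tuple v L in y my lawy indy *.
pose dk (k : {ffun bool -> bool * 'I_N}) := \prod_e dd (k e).2.
have dk0 k : 0 <= dk k by apply: prodr_ge0.
pose a (k : {ffun bool -> bool * 'I_N}) (j : 'I_(size w)) t :=
  linform (plane_form Lam k w`_j) (plane_form Lam k (w`_j * 'i%C)) (reim (y j t)).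
have ma k j : measurable_fun setT (a k j).
  exact: measurableT_comp (measurable_linform _ _) (my j).
pose W t := \sum_(j < size w) w`_j * y j t.
have WE k t : plane_form Lam k (W t) = \sum_j a k j t.
  by rewrite plane_form_sum; apply: eq_bigr => j _; rewrite plane_form_linform.
pose phi (k : {ffun bool -> bool * 'I_N}) u :=
  1 - mu / 2 * Ex P1 (fun t => 1 - cos (plane_form Lam k (u * (x1 t - x2 t)))).
have mxmu : complexRV xmu.
  have mr : measurable_fun setT (fun b : bool => b%:R : R) by [].
  have mIr : measurable_fun setT (fun t => (I t)%:R : R) by exact: measurableT_comp mr mI.
  have [/measurable_fun_pairP[p1 q1] /measurable_fun_pairP[p2 q2]] := (m1, m2).
  apply/measurable_fun_pairP; split.
    rewrite (_ : _ \o _ = fun t => (complex.Re (x1 t) - complex.Re (x2 t)) * (I t)%:R).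
      by apply: measurable_funM => //; apply: measurable_funB.
    apply/funext => t /=; rewrite xmuE.
    by case: (I t); rewrite ?mulr1 ?mulr0 //; case: (x1 t) (x2 t) => ? ? [? ?].
  rewrite (_ : _ \o _ = fun t => (complex.Im (x1 t) - complex.Im (x2 t)) * (I t)%:R).
    by apply: measurable_funM => //; apply: measurable_funB.
  apply/funext => t /=; rewrite xmuE.
  by case: (I t); rewrite ?mulr1 ?mulr0 //; case: (x1 t) (x2 t) => ? ? [? ?].
have char k j : Ex P2 (fun t => cos (a k j t)) = phi k w`_j /\ Ex P2 (fun t => sin (a k j t)) = 0.
  set al := plane_form Lam k w`_j; set be := plane_form Lam k (w`_j * 'i%C).
  have ml := measurable_linform al be.
  have := lazy_char al be mx m1 m2 mI l1 l2 i12 PI iI.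
  under eq_fun do rewrite -xmuE; under [in X in _ /\ X]eq_fun do rewrite -xmuE.
  rewrite (Ex_same_law mxmu (my j) (lawy j) (bounded_rv_cos ml)).
  rewrite (Ex_same_law mxmu (my j) (lawy j) (bounded_rv_sin ml)).
  case=> -> ->; split=> //; rewrite /phi; congr (1 - _ * Ex P1 _).
  by apply/funext => t; rewrite plane_form_linform.
have Ecos k : Ex P2 (fun t => cos (plane_form Lam k (W t))) =
    \prod_(i < r) phi k (v i) ^+ Num.truncn (L i ^+ 2).
  under eq_fun do rewrite WE.
  rewrite Ex_cos_sum //.
  - by rewrite -big_repeated_tuple; apply: eq_bigr => j _; have [] := char k j.
  - move=> B mB; have mB' (j : 'I_(size w)) : measurable (linform (plane_form Lam k w`_j)
        (plane_form Lam k (w`_j * 'i%C)) @^-1` B j).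
      by rewrite -[_ @^-1` _]setTI; apply: measurable_linform.
    exact: indy _ mB'.
  - by move=> j; have [] := char k j.
pose Z (k : {ffun bool -> bool * 'I_N}) t :=
  \sum_(i < r) M i ^+ 2 / 2 * (1 - cos (plane_form Lam k (v i * (x1 t - x2 t)))).
have mpf (k : {ffun bool -> bool * 'I_N}) u :
    measurable_fun setT (fun t => plane_form Lam k (u * (x1 t - x2 t))).
  pose l := linform (plane_form Lam k u) (plane_form Lam k (u * 'i%C)).
  rewrite (_ : (fun t => _) = fun t => l (reim (x1 t)) - l (reim (x2 t))).
    apply: measurable_funB.
      exact: measurableT_comp (measurable_linform _ _) m1.
    exact: measurableT_comp (measurable_linform _ _) m2.
  by apply/funext => t; rewrite plane_form_linform linformB.
have b1c (k : {ffun bool -> bool * 'I_N}) u :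
    bounded_rv (fun t => 1 - cos (plane_form Lam k (u * (x1 t - x2 t)))).
  by apply: bounded_rvB; [exact: bounded_rv_cst|exact: bounded_rv_cos].
have bZ k : bounded_rv (Z k) by apply: bounded_rv_sum => i; apply: bounded_rvZ.
have Z0 k t : 0 <= Z k t.
  by apply: sumr_ge0 => i _; rewrite mulr_ge0 ?divr_ge0 ?sqr_ge0 // subr_ge0 cos_le1.
(* The inequality 1 - u <= exp(-u) is raised to the power L_i^2, and mu L_i^2 = M_i^2. Monotonicity
   of the power needs a nonnegative base, which follows from mu <= 1 and s <= 2. *)
have prod_le k : \prod_(i < r) phi k (v i) ^+ Num.truncn (L i ^+ 2) <= expR (- Ex P1 (Z k)).
  rewrite Ex_sum => [|i]; last exact: bounded_rvZ.
  rewrite -sumrN expR_sum; apply: ler_prod => i _.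
  rewrite ExZ //; set s := Ex P1 _.
  have s0 : 0 <= s.
    rewrite -(Ex_cst P1 0).
    apply: (Ex_le P1 (bounded_rv_cst T1 0) (b1c k (v i))) => t.
    by rewrite subr_ge0 cos_le1.
  have s2 : s <= 2.
    rewrite -(Ex_cst P1 2).
    apply: (Ex_le P1 (b1c k (v i)) (bounded_rv_cst T1 2)) => t.
    by have := cos_geN1 (plane_form Lam k (v i * (x1 t - x2 t))); lra.
  have ph0 : 0 <= phi k (v i) by rewrite /phi -/s; nra.
  rewrite exprn_ge0 //=.
  have nL : (Num.truncn (L i ^+ 2))%:R = L i ^+ 2.
    by apply: truncnK; rewrite natrEint Lint sqr_ge0.
  have -> : - (M i ^+ 2 / 2 * s) = (- (mu / 2 * s)) * (Num.truncn (L i ^+ 2))%:R.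
    by rewrite nL /M exprMn sqr_sqrtr ?(ltW mu0) //; ring.
  rewrite expRM_natr lerXn2r ?nnegrE ?expR_ge0 //.
  by rewrite /phi -/s; apply: expR_ge1Dx.
have bsum : bounded_rv (fun t => \sum_k dk k * cos (plane_form Lam k (W t))).
  apply: bounded_rv_sum => k; apply: bounded_rvZ; apply: bounded_rv_cos.
  by rewrite (funext (WE k)); apply: measurable_sum.
have bgauss : bounded_rv (fun t => expR (- (pi * cabs (W t) ^+ 2)) : R).
  split; last first.
    exists 1 => t; rewrite ger0_norm ?expR_ge0 // -expR0 ler_expR oppr_le0.
    by rewrite mulr_ge0 ?pi_ge0 // sqr_ge0.
  have mW e : measurable_fun setT (fun t => coord e (W t)).
    rewrite (_ : (fun t => _) = fun t => \sum_(j < size w)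
      linform (coord e w`_j) (coord e (w`_j * 'i%C)) (reim (y j t))).
      by apply: measurable_sum => j; exact: measurableT_comp (measurable_linform _ _) (my j).
    by apply/funext => t; rewrite coord_sum; apply: eq_bigr => j _; rewrite coord_mul.
  under eq_fun do rewrite cabs_sqr.
  apply: (measurableT_comp (@measurable_expR R)); apply: measurableT_comp => //.
  by apply: measurable_funM => //; apply: measurable_funD; apply: measurable_funX.
rewrite /gaussian_mean expectation_Ex // lee_fin.
apply: (@le_trans _ _ (Ex P2 (fun t => \sum_k dk k * cos (plane_form Lam k (W t))))).
  by apply: Ex_le => // t; apply: gauss_le_plane_sum.
rewrite Ex_sum => [|k]; last first.
  apply: bounded_rvZ; apply: bounded_rv_cos.
  by rewrite (funext (WE k)); apply: measurable_sum.
apply: (@le_trans _ _ (\sum_k dk k * expR (- Ex P1 (Z k)))).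
  apply: ler_sum => k _; rewrite ExZ; last first.
    by apply: bounded_rv_cos; rewrite (funext (WE k)); apply: measurable_sum.
  by rewrite ler_wpM2l // Ecos.
(* Jensen on the separation event fixes a sample point t, hence a single y = x1 t - x2 t of
   controlled modulus. *)
apply: (sum_exp_Ex_le (A := A) (p0 := p0)) => //; first by rewrite p00.
move=> t At.
apply: (@le_trans _ _ (\sum_k dk k * ((8 / p0) ^+ r *
   \prod_i pkernel (Num.truncn (M i)).+1 (plane_form Lam k ((x1 t - x2 t) * v i))))).
  apply: ler_sum => k _; rewrite ler_wpM2l //.
  rewrite /Z mulr_sumr -sumrN expR_sum.
  have -> : (8 / p0) ^+ r = \prod_(i < r) (8 / p0) by rewrite prodr_const card_ord.
  rewrite -big_split /=; apply: ler_prod => i _.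
  by rewrite expR_ge0 /= [v i * _]mulrC; apply: exp_le_pkernel => //; rewrite p00.
rewrite (eq_bigr _ (fun k _ => mulrCA _ _ _)) -mulr_sumr.
apply: ler_wpM2l; first by rewrite exprn_ge0 // divr_ge0 // ltW.
exact: HS (Asep t At).
Qed.

Unset Implicit Arguments.

Theorem theorem6p6 (R : realType) (kappa eps : R) (r : nat)
    (hkappa : 1 <= kappa) (heps : 0 < eps) (hr : (1 <= r)%N) :
  exists C : R,
    forall (d : measure_display) (T : measurableType d) (P : probability T R)
      (x : T -> R[i]) (mu : R) (v : 'I_r -> R[i]) (L : 'I_r -> R),
    complexRV x ->
    controlled_second_moment P kappa x ->
    0 < mu <= 1 ->
    (forall i, 0 < L i) ->
    (forall i, L i ^+ 2 \is a Num.int) ->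
    forall (d1 : measure_display) (T1 : measurableType d1)
      (P1 : probability T1 R) (xmu : T1 -> R[i]),
    lazy_difference P x mu P1 xmu ->
    forall (d2 : measure_display) (T2 : measurableType d2)
      (P2 : probability T2 R)
      (y : 'I_(size (repeated_tuple v L)) -> T2 -> R[i]),
    iid_copies P1 xmu P2 y ->
    (gaussian_mean P2 y <=
       (C * dispersion (symGAP v (fun i => Num.sqrt mu * L i))
              `^ (-1 + eps))%R%:E)%E.
Proof.
pose Cst := (8 / (kappa^-1 ^+ 6 / 4)) ^+ r *
  (48 ^+ r * (4 * (1 + 2 / ((kappa^-1 ^+ 2) ^+ 2 / 16))) ^+ 2).
exists Cst => d T P x mu v L mx Hx hmu L0 Lint d1 T1 P1 xmu hxmu d2 T2 P2 y hy.
apply: le_trans (gaussian_mean_le_dispersion hkappa mx Hx hmu L0 Lint hxmu hy) _.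
have D1 : 1 <= dispersion (symGAP v (fun i => Num.sqrt mu * L i)).
  by apply: dispersion_ge1 => i; rewrite mulr_ge0 ?sqrtr_ge0 // ltW.
have ki : 0 <= kappa^-1 by rewrite invr_ge0; lra.
rewrite lee_fin mulrA; apply: ler_wpM2l.
  apply: mulr_ge0; first by rewrite exprn_ge0 // !divr_ge0 // exprn_ge0.
  by apply: mulr_ge0; [rewrite exprn_ge0|exact: sqr_ge0].
(* The dispersion is at least 1, so enlarging the exponent from -1 to -1 + eps enlarges the
   bound. *)
by rewrite -powR_inv1 ?ler_powR //; lra.
Qed.
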